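(* Thompson's group $T$ contains an isomorphic copy of the rearrangement group $T_A$ of the Airplane limit space; that is, $T$ has a subgroup isomorphic to $T_A$.
   Context: The Airplane rearrangement group $T_A$. Graphs are finite directed multigraphs with edges coloured red or blue. The base graph $\Gamma$ has vertices $l,a,b,r$, blue edges $e_L:a\to l$ and $e_R:b\to r$, and red edges $e_U:b\to a$ and $e_D:a\to b$. Replacement rules: a red edge from $v_i$ to $v_t$ is replaced by the graph with vertices $v_i,v_t$ and two new vertices $m,w$, with red edges $\mathsf r_1:v_i\to m$, $\mathsf r_2:m\to v_t$ and a blue edge $\mathsf s:m\to w$; a blue edge from $v_i$ to $v_t$ is replaced by the graph with vertices $v_i,v_t$ and two new vertices $x,y$, with blue edges $\mathsf b_-:x\to v_i$, $\mathsf b_+:y\to v_t$ and red edges $\mathsf u:y\to x$, $\mathsf d:x\to y$. An expansion is any graph obtained from $\Gamma$ by finitely many (possibly zero) replacements of single edges. Each edge of an expansion is named by the finite word $e_0e_1\cdots e_k$ recording the edge $e_0$ of $\Gamma$ from which it descends and the successive edges of replacement graphs. Let $\Gamma_0=\Gamma$, and let $\Gamma_{n+1}$ be obtained from $\Gamma_n$ by replacing every edge. Let $\Omega$ be the set of infinite words all of whose finite nonempty prefixes name edges (topologized as a subspace of a product of finite discrete sets). Two such words $e_0e_1\cdots$ and $f_0f_1\cdots$ are equivalent if for every $n$ the edges $e_0\cdots e_n$ and $f_0\cdots f_n$ of $\Gamma_n$ share at least one vertex; this is an equivalence relation, and the Airplane limit space $A$ is the quotient of $\Omega$ by it, with the quotient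 topology. The cell $\chi(e)$ of an edge $e$ is the set of points of $A$ represented by words beginning with $e$. A cellular partition is a cover of $A$ by finitely many cells with pairwise disjoint interiors. If $e,e'$ are edges of the same colour, the canonical homeomorphism $\chi(e)\to\chi(e')$ sends the class of $ew$ to the class of $e'w$. A rearrangement is a homeomorphism $f:A\to A$ for which there is a cellular partition such that $f$ restricts on each of its cells to a canonical homeomorphism onto some cell. Rearrangements form a group $T_A$ under composition. Thompson's group $T$. A dyadic subdivision of $[0,1]$ is a partition obtained by finitely many times halving intervals, starting from $[0,1]$; dyadic subdivisions of $S^1=[0,1]/\{0,1\}$ are their images. $T$ is the group of orientation-preserving piecewise linear homeomorphisms of $S^1$ that map linearly the intervals of one dyadic subdivision of $S^1$ onto those of another. *)

(* Defs.v *)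
From HB Require Import structures.
From mathcomp Require Import all_boot all_order all_algebra.
From mathcomp Require Import all_classical all_reals all_analysis.

Set Implicit Arguments.
Unset Strict Implicit.
Unset Printing Implicit Defensive.

Import Order.TTheory GRing.Theory Num.Theory.
Import numFieldNormedType.Exports.

Local Open Scope classical_set_scope.
Local Open Scope quotient_scope.

(** * The group of self-homeomorphisms of a topological space *)

Record homeo (X : topologicalType) := Homeo {
  homeo_fun :> X -> X;
  homeo_inv : X -> X;
  homeo_continuous : continuous homeo_fun;
  homeo_inv_continuous : continuous homeo_inv;
  homeoK : cancel homeo_fun homeo_inv;
  homeo_invK : cancel homeo_inv homeo_fun }.

Section HomeoGroup.
Variable X : topologicalType.
Implicit Types f g : homeo X.

Lemma homeo_ext f g : homeo_fun f = homeo_fun g -> f = g.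
Proof.
case: f => f f' cf cf' fK f'K; case: g => g g' cg cg' gK g'K /= fg.
move: cf fK f'K; rewrite fg => cf fK f'K.
have e : f' = g'.
  by apply: boolp.funext => x; rewrite -[in LHS](g'K x) fK.
move: cf' fK f'K; rewrite e => cf' fK f'K.
by congr Homeo; apply: Prop_irrelevance.
Qed.

Definition homeo1 : homeo X :=
  @Homeo X id id (fun x => @cvg_id _ (nbhs x)) (fun x => @cvg_id _ (nbhs x))
    (fun=> erefl) (fun=> erefl).

Lemma homeo_comp_continuous (f g : X -> X) :
  continuous f -> continuous g -> continuous (f \o g).
Proof. by move=> cf cg x; apply: continuous_comp; [exact: cg|exact: cf]. Qed.

Definition homeo_mul f g : homeo X :=
  @Homeo X (f \o g) (homeo_inv g \o homeo_inv f)
    (homeo_comp_continuous (@homeo_continuous _ f) (@homeo_continuous _ g))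
    (homeo_comp_continuous (@homeo_inv_continuous _ g)
                           (@homeo_inv_continuous _ f))
    (can_comp (@homeoK _ f) (@homeoK _ g))
    (can_comp (@homeo_invK _ g) (@homeo_invK _ f)).

Definition homeo_invg f : homeo X :=
  Homeo (@homeo_inv_continuous _ f) (@homeo_continuous _ f)
        (@homeo_invK _ f) (@homeoK _ f).

HB.instance Definition _ := gen_eqMixin (homeo X).
HB.instance Definition _ := gen_choiceMixin (homeo X).

Lemma homeo_mulA : associative homeo_mul.
Proof. by move=> f g h; exact: homeo_ext. Qed.

Lemma homeo_mul1 : left_id homeo1 homeo_mul.
Proof. by move=> f; exact: homeo_ext. Qed.

Lemma homeo_mulr1 : right_id homeo1 homeo_mul.
Proof. by move=> f; exact: homeo_ext. Qed.

Lemma homeo_mulV : left_inverse homeo1 homeo_invg homeo_mul.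
Proof.
by move=> f; apply: homeo_ext; apply: boolp.funext => x /=; rewrite homeoK.
Qed.

Lemma homeo_mulrV : right_inverse homeo1 homeo_invg homeo_mul.
Proof.
by move=> f; apply: homeo_ext; apply: boolp.funext => x /=; rewrite homeo_invK.
Qed.

HB.instance Definition _ := isGroup.Build (homeo X)
  homeo_mulA homeo_mul1 homeo_mulr1 homeo_mulV homeo_mulrV.

End HomeoGroup.

(** * Subgroups *)

Definition is_subgroup (G : groupType) (H : set G) : Prop :=
  group_closed [pred x : G | x \in H].

Definition subgroup_isomorphic (G G' : groupType) (H : set G) (H' : set G') :
    Prop :=
  [/\ is_subgroup H, is_subgroup H' &
    exists phi : G -> G',
      set_bij H H' phi /\
      forall x y, H x -> H y -> phi (x * y)%g = (phi x * phi y)%g].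

(** * The Airplane replacement system *)

Inductive colour := Red | Blue.

(* The edges of the base graph and of the two replacement graphs;
   [bs], [bm], [bp], [eu], [ed] are s, b_-, b_+, u and d. *)
Inductive letter := eL | eR | eU | eD | r1 | r2 | bs | bm | bp | eu | ed.

(* The vertices of the base graph and the new ones of the replacement graphs. *)
Inductive vlabel := vl | va | vb | vr | vm | vw | vx | vy.

Definition letters := [:: eL; eR; eU; eD; r1; r2; bs; bm; bp; eu; ed].

Definition letter_code (c : letter) : 'I_11 :=
  inord (match c with
    eL => 0 | eR => 1 | eU => 2 | eD => 3 | r1 => 4 | r2 => 5 | bs => 6
  | bm => 7 | bp => 8 | eu => 9 | ed => 10 end).

Definition letter_decode (i : 'I_11) : letter := nth eL letters i.

Lemma letter_codeK : cancel letter_code letter_decode.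
Proof. by case; rewrite /letter_decode /letter_code inordK. Qed.

HB.instance Definition _ := Finite.copy letter (can_type letter_codeK).

Definition vlabels := [:: vl; va; vb; vr; vm; vw; vx; vy].

Definition vlabel_code (c : vlabel) : 'I_8 :=
  inord (match c with
    vl => 0 | va => 1 | vb => 2 | vr => 3 | vm => 4 | vw => 5 | vx => 6
  | vy => 7 end).

Definition vlabel_decode (i : 'I_8) : vlabel := nth vl vlabels i.

Lemma vlabel_codeK : cancel vlabel_code vlabel_decode.
Proof. by case; rewrite /vlabel_decode /vlabel_code inordK. Qed.

HB.instance Definition _ := Finite.copy vlabel (can_type vlabel_codeK).

Definition colour_code (c : colour) : bool := if c is Red then true else false.
Definition colour_decode (b : bool) : colour := if b then Red else Blue.

Lemma colour_codeK : cancel colour_code colour_decode.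
Proof. by case. Qed.

HB.instance Definition _ := Finite.copy colour (can_type colour_codeK).

Definition word := seq letter.

(* The base vertices are ([::], _); the vertices created by the replacement of
   an edge named w are (w, _), so that they are fresh. *)
Definition vertex := (word * vlabel)%type.

Record edge := Edge {
  name : word; edge_colour : colour; source : vertex; target : vertex }.

Definition edge_tuple (e : edge) :=
  (name e, edge_colour e, source e, target e).
Definition tuple_edge (t : word * colour * vertex * vertex) :=
  let: (w, c, p, q) := t in Edge w c p q.

Lemma edge_tupleK : cancel edge_tuple tuple_edge.
Proof. by case. Qed.

HB.instance Definition _ := Countable.copy edge (can_type edge_tupleK).

(* No graph considered here has isolated vertices, so a graph is represented by
   the list of its edges. *)
Definition graph := seq edge.

Definition base_graph : graph :=
  let l := ([::], vl) in let a := ([::], va) in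
  let b := ([::], vb) in let r := ([::], vr) in
  [:: Edge [:: eL] Blue a l; Edge [:: eR] Blue b r;
      Edge [:: eU] Red b a; Edge [:: eD] Red a b].

Definition replacement (e : edge) : graph :=
  let i := source e in let t := target e in
  let new v := (name e, v) in let sub c := rcons (name e) c in
  match edge_colour e with
  | Red => [:: Edge (sub r1) Red i (new vm);
               Edge (sub r2) Red (new vm) t;
               Edge (sub bs) Blue (new vm) (new vw)]
  | Blue => [:: Edge (sub bm) Blue (new vx) i;
                Edge (sub bp) Blue (new vy) t;
                Edge (sub eu) Red (new vy) (new vx);
                Edge (sub ed) Red (new vx) (new vy)]
  end.

Inductive expansion : graph -> Prop :=
| expansion_base : expansion base_graph
| expansion_replace g1 e g2 :
    expansion (g1 ++ e :: g2) -> expansion (g1 ++ replacement e ++ g2).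

Definition full_expansion (n : nat) : graph :=
  iter n (fun g => flatten (map replacement g)) base_graph.

Definition is_edge (e : edge) : Prop := exists2 g, expansion g & e \in g.

Definition names_edge (w : word) : Prop := exists2 e, is_edge e & name e = w.

Definition share_vertex (e f : edge) : bool :=
  has (mem [:: source f; target f]) [:: source e; target e].

Lemma replacement_name e e' :
  e' \in replacement e -> exists c, name e' = rcons (name e) c.
Proof.
rewrite /replacement; case: (edge_colour e); rewrite !inE;
  do ?[case/orP]; move/eqP->; by eexists.
Qed.

Lemma replacement_inj e e1 e2 : e1 \in replacement e -> e2 \in replacement e ->
  name e1 = name e2 -> e1 = e2.
Proof.
rewrite /replacement; case: (edge_colour e); rewrite !inE;
  do ?[case/orP]; move/eqP->; do ?[case/orP]; move/eqP-> => //=;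
  by case/rcons_inj.
Qed.

Lemma full_expansionS n e' : e' \in full_expansion n.+1 <->
  exists2 e, e \in full_expansion n & e' \in replacement e.
Proof.
rewrite /full_expansion iterS; split; first by case/flatten_mapP => e; exists e.
by case=> e ? ?; apply/flatten_mapP; exists e.
Qed.

Lemma full_expansion_size n e : e \in full_expansion n -> size (name e) = n.+1.
Proof.
elim: n e => [|n IHn] e.
  by rewrite /full_expansion !inE; do ?[case/orP]; move/eqP->.
case/full_expansionS => e0 /IHn szn /replacement_name [c ->].
by rewrite size_rcons szn.
Qed.

Lemma full_expansion_inj n e f : e \in full_expansion n ->
  f \in full_expansion n -> name e = name f -> e = f.
Proof.
elim: n e f => [|n IHn] e f.
  by rewrite /full_expansion !inE; do ?[case/orP]; move/eqP->;
    do ?[case/orP]; move/eqP->.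
case/full_expansionS => e0 e0n ee0 /full_expansionS [f0 f0n ff0] nef.
have [c ec] := replacement_name ee0; have [d fd] := replacement_name ff0.
have /rcons_inj[ef0 _] : rcons (name e0) c = rcons (name f0) d by rewrite -ec nef.
by move: ff0; rewrite -(IHn _ _ e0n f0n ef0) => /(replacement_inj ee0); apply.
Qed.

Lemma is_edge_full_expansion e :
  is_edge e -> e \in full_expansion (size (name e)).-1.
Proof.
case=> g gx; elim: gx e => [|g1 e0 g2 _ IH] e.
  by rewrite !inE; do ?[case/orP]; move/eqP->;
    rewrite /full_expansion /= !inE eqxx ?orbT.
rewrite !mem_cat => /or3P[eg|ee0|eg].
- by apply: IH; rewrite mem_cat eg.
- have /IH e0n : e0 \in g1 ++ e0 :: g2 by rewrite mem_cat mem_head orbT.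
  have e0S := full_expansion_size e0n.
  have [c ->] := replacement_name ee0; rewrite size_rcons /= e0S.
  by apply/full_expansionS; exists e0.
- by apply: IH; rewrite mem_cat inE eg !orbT.
Qed.

Lemma replacement_old e e' p : e' \in replacement e ->
  p \in [:: source e'; target e'] ->
  p \in [:: source e; target e] \/ p.1 = name e.
Proof.
rewrite /replacement; case: (edge_colour e); rewrite !inE;
  do ?[case/orP]; move/eqP-> => /=; case/orP=> /eqP->; rewrite ?eqxx ?orbT /=;
  by [left | right].
Qed.

Lemma full_expansion_vertex_size n e p : e \in full_expansion n ->
  p \in [:: source e; target e] -> size p.1 <= n.
Proof.
elim: n e => [|n IHn] e.
  by rewrite /full_expansion !inE; do ?[case/orP]; move/eqP-> => /=;
    case/orP=> /eqP->.
case/full_expansionS => e0 e0n ee0 /(replacement_old ee0)[/(IHn _ e0n)/leqW//|->].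
by rewrite (full_expansion_size e0n).
Qed.

Lemma replacement_shared n e f e' f' p : e \in full_expansion n ->
  f \in full_expansion n -> e != f ->
  e' \in replacement e -> f' \in replacement f ->
  p \in [:: source e'; target e'] -> p \in [:: source f'; target f'] ->
  p \in [:: source e; target e] /\ p \in [:: source f; target f].
Proof.
move=> en fn /eqP nef ee ff pe pf.
have [] := replacement_old ee pe; have [] := replacement_old ff pf => //.
- move=> pn /(full_expansion_vertex_size en).
  by rewrite pn (full_expansion_size fn) ltnn.
- move=> /(full_expansion_vertex_size fn) + pn.
  by rewrite pn (full_expansion_size en) ltnn.
- by move=> -> /(full_expansion_inj fn en) /esym/nef.
Qed.

Lemma replacement_ends n e e' p q : e \in full_expansion n ->
  e' \in replacement e ->
  p \in [:: source e; target e] -> q \in [:: source e; target e] ->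
  p \in [:: source e'; target e'] -> q \in [:: source e'; target e'] -> p = q.
Proof.
move=> en ee pe qe.
have new v : (name e, v) \in [:: source e; target e] -> False.
  by move/(full_expansion_vertex_size en); rewrite /= (full_expansion_size en) ltnn.
move: ee; rewrite /replacement; case: (edge_colour e); rewrite !inE;
  do ?[case/orP]; move/eqP-> => /= /orP[]/eqP pE /orP[]/eqP qE;
  first [ by rewrite pE qE
        | by case: (new vm); rewrite -pE
        | by case: (new vm); rewrite -qE
        | by case: (new vw); rewrite -pE
        | by case: (new vw); rewrite -qE
        | by case: (new vx); rewrite -pE
        | by case: (new vx); rewrite -qE
        | by case: (new vy); rewrite -pE
        | by case: (new vy); rewrite -qE ].
Qed.

(** * The limit space *)

Definition symbols : topologicalType := {ptws nat -> discrete_topology letter}.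

Definition prefix_word (z : nat -> letter) (n : nat) : word := mkseq z n.

Definition Omega : set symbols :=
  [set z | forall n, names_edge (prefix_word z n.+1)].

Definition glued (z z' : Omega) : Prop :=
  forall n, exists e f,
    [/\ e \in full_expansion n, f \in full_expansion n,
        name e = prefix_word (val z) n.+1, name f = prefix_word (val z') n.+1
      & share_vertex e f].

Definition gluing : rel Omega := fun z z' => `[< glued z z' >].

Lemma Omega_edge (z : Omega) n :
  exists2 e, e \in full_expansion n & name e = prefix_word (val z) n.+1.
Proof.
have /set_mem/(_ n)[e /is_edge_full_expansion + en] := valP z.
by rewrite en size_mkseq => ?; exists e.
Qed.

Lemma share_vertexP e f :
  reflect (exists2 p, p \in [:: source e; target e]
                    & p \in [:: source f; target f]) (share_vertex e f).
Proof. exact: hasP. Qed.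

Lemma prefix_wordS (z : nat -> letter) n :
  prefix_word z n.+1 = rcons (prefix_word z n) (z n).
Proof. exact: mkseqS. Qed.

Lemma Omega_edgeS (z : Omega) n e e' : e \in full_expansion n ->
  name e = prefix_word (val z) n.+1 -> e' \in full_expansion n.+1 ->
  name e' = prefix_word (val z) n.+2 -> e' \in replacement e.
Proof.
move=> en ez /full_expansionS[e0 e0n e'e0] e'z.
suff -> : e = e0 by [].
apply: full_expansion_inj en e0n _; rewrite ez.
have [c] := replacement_name e'e0.
by rewrite e'z prefix_wordS => /rcons_inj[].
Qed.

Lemma gluing_refl : reflexive gluing.
Proof.
move=> z; apply/asboolP => n; have [e en ez] := Omega_edge z n.
by exists e, e; split=> //; apply/share_vertexP; exists (source e);
  rewrite mem_head.
Qed.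

Lemma gluing_sym : symmetric gluing.
Proof.
suff sub z z' : gluing z z' -> gluing z' z by move=> z z'; apply/idP/idP; apply: sub.
move=> /asboolP zz'; apply/asboolP => n.
have [e [f [en fn ez fz /share_vertexP[p pe pf]]]] := zz' n.
by exists f, e; split=> //; apply/share_vertexP; exists p.
Qed.

Lemma gluing_trans : transitive gluing.
Proof.
move=> z2 z1 z3 /asboolP z12 /asboolP z23; apply/asboolP => n.
have [e [f [en fn ez fz ef]]] := z12 n.
have [f1 [g [fn1 gn fz1 gz fg]]] := z23 n.
have {fn1 fz1} ff1 : f1 = f.
  by apply: full_expansion_inj fn1 fn _; rewrite fz fz1.
rewrite {f1}ff1 in fg.
exists e, g; split=> //.
have [->//|nef] := eqVneq e f.
have [<-//|nfg] := eqVneq f g.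
have [e' [f' [en' fn' ez' fz' /share_vertexP[p pe pf]]]] := z12 n.+1.
have [f1 [g' [fn1 gn' fz1 gz' /share_vertexP[q qf qg]]]] := z23 n.+1.
have {fn1 fz1} ff1 : f1 = f'.
  by apply: full_expansion_inj fn1 fn' _; rewrite fz' fz1.
rewrite {f1}ff1 in qf.
have ee := Omega_edgeS en ez en' ez'.
have ff := Omega_edgeS fn fz fn' fz'.
have gg := Omega_edgeS gn gz gn' gz'.
have [pe0 pf0] := replacement_shared en fn nef ee ff pe pf.
have [qf0 qg0] := replacement_shared fn gn nfg ff gg qf qg.
apply/share_vertexP; exists p => //.
by rewrite (replacement_ends fn ff pf0 qf0 pf qf).
Qed.

Canonical gluing_equiv := EquivRel gluing gluing_refl gluing_sym gluing_trans.

Definition airplane : topologicalType :=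
  quotient_topology {eq_quot gluing_equiv}.

Definition airplane_class (z : Omega) : airplane := \pi_{eq_quot gluing_equiv} z.

Definition cell (e : edge) : set airplane :=
  [set airplane_class z
     | z in [set z : Omega | prefix_word (val z) (size (name e)) = name e]].

Definition cellular_partition (P : seq edge) : Prop :=
  [/\ forall e, e \in P -> is_edge e,
      \bigcup_(e in [set` P]) cell e = setT
    & forall e e', e \in P -> e' \in P -> e != e' ->
        interior (cell e) `&` interior (cell e') = set0].

Definition cat_word (v : word) (w : nat -> letter) : nat -> letter :=
  fun n => if n < size v then nth eL v n else w (n - size v).

(* f restricts to the canonical homeomorphism from the cell of e to that of e',
   which only makes sense for edges of the same colour. *)
Definition restricts_to_canonical (f : airplane -> airplane) (e e' : edge) :
    Prop :=
  edge_colour e = edge_colour e' /\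
  forall (w : nat -> letter) (z z' : Omega),
    val z = cat_word (name e) w -> val z' = cat_word (name e') w ->
    f (airplane_class z) = airplane_class z'.

Definition rearrangement (f : homeo airplane) : Prop :=
  exists2 P, cellular_partition P &
    forall e, e \in P -> exists2 e', is_edge e' & restricts_to_canonical f e e'.

Definition T_A : set (homeo airplane) := [set f | rearrangement f].

(** * Thompson's group T *)

Section Thompson.
Variable R : realType.
Local Open Scope ring_scope.

Definition unit_interval : set R := `[0, 1]%classic.

Definition endpoint (x : unit_interval) : bool :=
  (val x == 0) || (val x == 1).

Definition identified : rel unit_interval :=
  fun x y => (x == y) || (endpoint x && endpoint y).

Lemma identified_refl : reflexive identified.
Proof. by move=> x; rewrite /identified eqxx. Qed.

Lemma identified_sym : symmetric identified.
Proof. by move=> x y; rewrite /identified eq_sym andbC. Qed.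

Lemma identified_trans : transitive identified.
Proof.
move=> y x z /orP[/eqP->//|/andP[ex ey]] /orP[/eqP<-|/andP[_ ez]];
  by rewrite /identified ex ?ey ?ez orbT.
Qed.

Canonical identified_equiv :=
  EquivRel identified identified_refl identified_sym identified_trans.

Definition circle : topologicalType :=
  quotient_topology {eq_quot identified_equiv}.

Definition circle_class (x : unit_interval) : circle :=
  \pi_{eq_quot identified_equiv} x.

(* A subdivision is the list of the endpoints of its intervals. *)
Inductive dyadic_subdivision : seq (R * R) -> Prop :=
| dyadic_unit : dyadic_subdivision [:: (0, 1)]
| dyadic_halve D1 a b D2 :
    dyadic_subdivision (D1 ++ (a, b) :: D2) ->
    dyadic_subdivision (D1 ++ (a, (a + b) / 2) :: ((a + b) / 2, b) :: D2).

(* f maps the image of [a, b] onto that of [c, d] by the increasing affine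
   bijection, i.e. linearly and preserving the orientation. *)
Definition maps_linearly (f : circle -> circle) (I J : R * R) : Prop :=
  forall x y : unit_interval,
    I.1 <= val x <= I.2 ->
    val y = J.1 + (J.2 - J.1) / (I.2 - I.1) * (val x - I.1) ->
    f (circle_class x) = circle_class y.

Definition thompson_T : set (homeo circle) :=
  [set f | exists D D',
     [/\ dyadic_subdivision D, dyadic_subdivision D',
         forall I, I \in D -> exists2 J, J \in D' & maps_linearly f I J
       & forall J, J \in D' -> exists2 I, I \in D & maps_linearly f I J]].

End Thompson.

Arguments unit_interval : clear implicits.
Arguments thompson_T : clear implicits.

(* Main.v *)
Require Import Defs.
From HB Require Import structures.
From mathcomp Require Import all_boot all_order all_algebra.
From mathcomp Require Import all_classical all_reals all_analysis.
From mathcomp Require Import zify ring lra.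

Set Implicit Arguments.
Unset Strict Implicit.
Unset Printing Implicit Defensive.

Import Order.TTheory GRing.Theory Num.Theory.
Import numFieldNormedType.Exports.

Local Open Scope classical_set_scope.
Local Open Scope quotient_scope.

(** The Airplane lies in the plane, and walking once around it from outside runs
    along one side of every red edge and along both sides of every blue edge. The
    circle is thus divided into arcs, one arc [Rim] over each red edge and two arcs
    over each blue edge, [Out] from its source to its target and [Back] from its
    target to its source. Replacing an edge divides each of its arcs, always in the
    same way for a given kind of arc:
      the circle is  Out eL, Back eL, Rim eD, Out eR, Back eR, Rim eU;
      Rim  is  Rim r1, Out s, Back s, Rim r2;
      Out  is  Back b_-, Rim d, Out b_+;
      Back  is  Back b_+, Rim u, Out b_-.
    The lengths are chosen so that each division is dyadic; [place] gives the
    resulting coordinates.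

    A rearrangement exchanges prefixes: on the cell of a word w of a fixed large
    length it replaces w by another word w'. Its lift to the circle sends each arc
    over w linearly onto the arc of the same kind over w'. What has to be shown is
    that these linear pieces agree where they meet ([lift_unique]). Arcs that meet
    in an end lie over words with a common vertex there ([meet_corner]), and a
    vertex together with one bit, telling whether the walk is about to leave a red
    edge or has come back to one, determines a point of the circle
    ([spot_corner]). Vertices are points of the limit space, namely classes of
    words that are eventually constant ([touch_end_word]), so the rearrangement
    respects common vertices; the bit depends only on the kind of arc. The bit may
    jump without a change of place only at a tip, a vertex of degree one. A tip is
    a vertex represented by one word only ([tip_touch]) whereas every other vertex
    is also an end of red edges ([red_end]), so tips go to tips ([canonical_tip]).

    The lift is then a homeomorphism of the circle, with the lift of the inverse as
    its inverse. It belongs to T, since the arcs over the words of a given length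
    and the arcs over their images are both dyadic subdivisions. Lifting is
    multiplicative because prefix exchanges compose, and injective because the arcs
    over a word determine the word ([arc_inj]).

    The topology of the limit space matters only for the passage between cellular
    partitions and words of a given length ([T_A_canonical_at]). It rests on words
    that contain r1 r2 infinitely often: they are glued to no other word
    ([zigzag_touch]) and are dense, so that cells which cover the limit space cover
    all words, and distinct cells of a full expansion have disjoint interiors. *)

(** * Words and the edges that they name *)

Definition letter_colour (c : letter) : colour :=
  match c with eU | eD | r1 | r2 | eu | ed => Red | _ => Blue end.

(** The colour of the edges whose replacement graph contains the given edge;
    [None] stands for the base graph. *)
Definition grows_on (c : letter) : option colour :=
  match c with
  | eL | eR | eU | eD => None
  | r1 | r2 | bs => Some Red
  | bm | bp | eu | ed => Some Blue
  end.

Definition last_colour (o : option colour) (w : word) : option colour :=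
  last o [seq Some (letter_colour c) | c <- w].

Fixpoint wf (o : option colour) (w : word) : bool :=
  if w is c :: s then (grows_on c == o) && wf (Some (letter_colour c)) s
  else true.

Notation valid := (wf None).

Lemma wf_cat o v w : wf o (v ++ w) = wf o v && wf (last_colour o v) w.
Proof. by elim: v o => //= c v IH o; rewrite IH andbA. Qed.

Lemma wf_rcons o w c :
  wf o (rcons w c) = wf o w && (grows_on c == last_colour o w).
Proof. by rewrite -cats1 wf_cat /= andbT. Qed.

Lemma valid_rcons_inv w c : valid (rcons w c) -> valid w.
Proof. by rewrite wf_rcons => /andP[]. Qed.

Lemma last_colour_cat o v w :
  last_colour o (v ++ w) = last_colour (last_colour o v) w.
Proof. by rewrite /last_colour map_cat last_cat. Qed.

Lemma last_colour_rcons o w c :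
  last_colour o (rcons w c) = Some (letter_colour c).
Proof. by rewrite /last_colour map_rcons last_rcons. Qed.

Definition child (e : edge) (c : letter) : edge :=
  let new v := (name e, v) in let old v := ([::], v) in
  let sub := Edge (rcons (name e) c) (letter_colour c) in
  match c with
  | eL => sub (old va) (old vl)
  | eR => sub (old vb) (old vr)
  | eU => sub (old vb) (old va)
  | eD => sub (old va) (old vb)
  | r1 => sub (source e) (new vm)
  | r2 => sub (new vm) (target e)
  | bs => sub (new vm) (new vw)
  | bm => sub (new vx) (source e)
  | bp => sub (new vy) (target e)
  | eu => sub (new vy) (new vx)
  | ed => sub (new vx) (new vy)
  end.

(** The value at the empty word serves as the parent of the base edges, whose
    ends do not depend on it. *)
Definition edge_at (w : word) : edge :=
  foldl child (Edge [::] Red ([::], va) ([::], va)) w.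

Lemma edge_at_rcons w c : edge_at (rcons w c) = child (edge_at w) c.
Proof. by rewrite /edge_at -cats1 foldl_cat. Qed.

Lemma name_edge_at w : name (edge_at w) = w.
Proof. by elim/last_ind: w => // w c IH; rewrite edge_at_rcons -{2}IH; case: c. Qed.

Lemma colour_edge_at w :
  w != [::] -> last_colour None w = Some (edge_colour (edge_at w)).
Proof.
by elim/last_ind: w => // w c _ _; rewrite edge_at_rcons last_colour_rcons; case: c.
Qed.

Lemma child_replacement w c : valid (rcons w c) -> w != [::] ->
  edge_at (rcons w c) \in replacement (edge_at w).
Proof.
rewrite wf_rcons => /andP[_ +] w0; rewrite (colour_edge_at w0) edge_at_rcons.
rewrite /replacement name_edge_at /child name_edge_at.
by case: (edge_colour _); case: c => // _; rewrite !inE eqxx ?orbT.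
Qed.

Lemma edge_at_full_expansion w : valid w -> w != [::] ->
  edge_at w \in full_expansion (size w).-1.
Proof.
elim/last_ind: w => // w c IH vw _; rewrite size_rcons /=.
have vw' := valid_rcons_inv vw.
have [w0|w0] := eqVneq w [::].
  by move: vw; rewrite w0 /full_expansion /=; case: c => // _;
    rewrite /edge_at /= !inE eqxx ?orbT.
case sw : (size w) => [|n]; first by move/size0nil: sw w0 => ->.
apply/full_expansionS; exists (edge_at w); last exact: child_replacement.
by have := IH vw' w0; rewrite sw.
Qed.

Lemma edge_at_is_edge w : valid w -> w != [::] -> is_edge (edge_at w).
Proof.
elim/last_ind: w => // w c IH vw _.
have vw' := valid_rcons_inv vw.
have [w0|w0] := eqVneq w [::].
  exists base_graph; first exact: expansion_base.
  by move: vw; rewrite w0; case: c => // _; rewrite /edge_at /= !inE eqxx ?orbT.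
have [g eg wg] := IH vw' w0.
have [g1 [g2 gE]] : exists g1 g2, g = g1 ++ edge_at w :: g2.
  by case/splitPr: wg => g1 g2; exists g1, g2.
exists (g1 ++ replacement (edge_at w) ++ g2).
  by apply: expansion_replace; rewrite -gE.
by rewrite !mem_cat (child_replacement vw w0) orbT.
Qed.

Lemma full_expansion_edge_at n e : e \in full_expansion n ->
  [/\ valid (name e), size (name e) = n.+1 & e = edge_at (name e)].
Proof.
elim: n e => [|n IH] e.
  by rewrite /full_expansion !inE; do ?[case/orP]; move/eqP->.
case/full_expansionS => f /IH[vf sf fE].
have f0 : name f != [::] by rewrite -size_eq0 sf.
have := colour_edge_at f0; rewrite -fE => cf.
have key c : e = child f c -> grows_on c = Some (edge_colour f) ->
    [/\ valid (name e), size (name e) = n.+2 & e = edge_at (name e)].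
  move=> eE gc; have ne : name e = rcons (name f) c by rewrite eE; case: (c).
  by rewrite ne wf_rcons vf cf gc eqxx size_rcons sf edge_at_rcons -fE.
rewrite /replacement; case cE: (edge_colour f); rewrite !inE.
  by case/or3P => /eqP eE; [apply: (key r1)|apply: (key r2)|apply: (key bs)];
    rewrite ?cE.
by case/or4P => /eqP eE; [apply: (key bm)|apply: (key bp)|apply: (key eu)
  |apply: (key ed)]; rewrite ?cE.
Qed.

Lemma is_edge_edge_at e :
  is_edge e -> [/\ valid (name e), name e != [::] & e = edge_at (name e)].
Proof.
case/is_edge_full_expansion/full_expansion_edge_at => ve sz eE; split=> //.
by rewrite -size_eq0 sz.
Qed.

Definition edge_end (e : edge) (b : bool) := if b then target e else source e.

Lemma edge_endP e p :
  reflect (exists b, p = edge_end e b) (p \in [:: source e; target e]).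
Proof.
rewrite !inE; apply: (iffP orP) => [[]/eqP->|[[]->] /=].
- by exists false.
- by exists true.
- by right.
- by left.
Qed.

Lemma edge_end_size w b : valid w -> w != [::] ->
  size (edge_end (edge_at w) b).1 < size w.
Proof.
move=> vw w0; have := edge_at_full_expansion vw w0.
move/full_expansion_vertex_size => /(_ (edge_end (edge_at w) b)).
have -> : edge_end (edge_at w) b \in [:: source (edge_at w); target (edge_at w)].
  by apply/edge_endP; exists b.
by move/(_ isT); case: w vw w0.
Qed.

Lemma edge_end_rcons w c b : valid (rcons w c) -> w != [::] ->
  (exists b', edge_end (edge_at (rcons w c)) b = edge_end (edge_at w) b') \/
  (edge_end (edge_at (rcons w c)) b).1 = w.
Proof.
move=> vw w0; have := @replacement_old _ _ (edge_end (edge_at (rcons w c)) b)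
  (child_replacement vw w0).
case; [by apply/edge_endP; exists b|move/edge_endP => [b' ->]|].
  by left; exists b'.
by rewrite name_edge_at; right.
Qed.

(** * Gluing of infinite words *)

Definition admissible (z : nat -> letter) : Prop :=
  forall n, valid (prefix_word z n).

(** The gluing relation with the edges computed from their names. *)
Definition touch (z z' : nat -> letter) : Prop :=
  forall n, share_vertex (edge_at (prefix_word z n.+1))
                         (edge_at (prefix_word z' n.+1)).

Lemma size_prefix z n : size (prefix_word z n) = n.
Proof. exact: size_mkseq. Qed.

Lemma prefix_neq0 z n : prefix_word z n.+1 != [::].
Proof. by rewrite -size_eq0 size_prefix. Qed.

Lemma admissible_Omega z : admissible z <-> Omega z.
Proof.
split=> [az n|Oz [|n] //].
  exists (edge_at (prefix_word z n.+1)); last by rewrite name_edge_at.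
  exact: edge_at_is_edge (az _) (prefix_neq0 _ _).
by case: (Oz n) => e /is_edge_edge_at[ve _ _] <-.
Qed.

Lemma prefix_inj z z' : (forall n, prefix_word z n = prefix_word z' n) -> z = z'.
Proof.
move=> h; apply: boolp.funext => n.
by have := h n.+1; rewrite !prefix_wordS => /rcons_inj[].
Qed.

Lemma prefix_le z z' m n : m <= n -> prefix_word z n = prefix_word z' n ->
  prefix_word z m = prefix_word z' m.
Proof.
move=> mn h; have := congr1 (take m) h.
rewrite /prefix_word /mkseq -!map_take !take_iota.
by have /minn_idPl-> := mn.
Qed.

Lemma cat_word_cat v w x : cat_word (v ++ w) x = cat_word v (cat_word w x).
Proof.
apply: boolp.funext => n; rewrite /cat_word size_cat nth_cat subnDA.
case: (ltnP n (size v)) => h; first by rewrite ltn_addr.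
by rewrite ltn_subLR.
Qed.

Lemma cat_word_shift z n : cat_word (prefix_word z n) (fun k => z (n + k)) = z.
Proof.
apply: boolp.funext => k; rewrite /cat_word size_prefix.
case: ltnP => h; first by rewrite nth_mkseq.
by rewrite subnKC.
Qed.

Lemma prefix_cat_word v x k :
  prefix_word (cat_word v x) (size v + k) = v ++ prefix_word x k.
Proof.
apply: (@eq_from_nth _ eL); rewrite ?size_cat ?size_prefix // => i hi.
rewrite nth_mkseq // nth_cat /cat_word; case: ltnP => h //.
by rewrite nth_mkseq // ltn_subLR.
Qed.

Lemma prefix_cat_word0 v x : prefix_word (cat_word v x) (size v) = v.
Proof. by have := prefix_cat_word v x 0; rewrite addn0 [_ ++ _]cats0. Qed.

Lemma admissible_le z m n : m <= n ->
  valid (prefix_word z n) -> valid (prefix_word z m).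
Proof.
move=> mn; rewrite -(subnK mn) addnC.
have -> : prefix_word z (m + (n - m)) =
    prefix_word z m ++ prefix_word (fun k => z (m + k)) (n - m).
  by rewrite -{1}(cat_word_shift z m) -{3}(size_prefix z m) prefix_cat_word.
by rewrite wf_cat => /andP[].
Qed.

Lemma admissible_cat v x : admissible (cat_word v x) <->
  valid v /\ forall n, wf (last_colour None v) (prefix_word x n).
Proof.
split=> [az|[vv vx] n].
  split=> [|n]; first by have := az (size v); rewrite prefix_cat_word0.
  by have := az (size v + n); rewrite prefix_cat_word wf_cat => /andP[].
apply: (@admissible_le _ _ (size v + n)); first exact: leq_addl.
by rewrite prefix_cat_word wf_cat vv vx.
Qed.

Lemma prefixes_comparable v w x y : cat_word v x = cat_word w y ->
  size v <= size w -> exists2 u, w = v ++ u & x = cat_word u y.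
Proof.
move=> e h; have wE : w = v ++ prefix_word x (size w - size v).
  by rewrite -prefix_cat_word subnKC // e prefix_cat_word0.
exists (prefix_word x (size w - size v)) => //.
move: e; rewrite {1}wE cat_word_cat => e.
apply: boolp.funext => n; move/(congr1 (fun f => f (size v + n))): e.
by rewrite /cat_word ltnNge leq_addr /= addKn.
Qed.

(** Once two words have different prefixes, replacement creates no new common
    vertices. *)
Lemma shared_by_parents z z' n p : admissible z -> admissible z' ->
  prefix_word z n.+1 != prefix_word z' n.+1 ->
  p \in [:: source (edge_at (prefix_word z n.+2));
            target (edge_at (prefix_word z n.+2))] ->
  p \in [:: source (edge_at (prefix_word z' n.+2));
            target (edge_at (prefix_word z' n.+2))] ->
  p \in [:: source (edge_at (prefix_word z n.+1));
            target (edge_at (prefix_word z n.+1))] /\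
  p \in [:: source (edge_at (prefix_word z' n.+1));
            target (edge_at (prefix_word z' n.+1))].
Proof.
move=> az az' ne.
have fe y : admissible y ->
    edge_at (prefix_word y n.+1) \in full_expansion n.
  move=> ay; have := edge_at_full_expansion (ay n.+1) (prefix_neq0 y n).
  by rewrite size_prefix.
apply: (replacement_shared (fe _ az) (fe _ az')).
- by apply: contra_neq ne => /(congr1 name); rewrite !name_edge_at.
- rewrite prefix_wordS; apply: child_replacement; last exact: prefix_neq0.
  by rewrite -prefix_wordS.
- rewrite prefix_wordS; apply: child_replacement; last exact: prefix_neq0.
  by rewrite -prefix_wordS.
Qed.

Lemma share_vertex_refl e : share_vertex e e.
Proof. by rewrite /share_vertex /= mem_head. Qed.

(** Sharing a vertex is inherited by shorter prefixes, so it suffices to test it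
    on long ones. *)
Lemma touch_large z z' m : admissible z -> admissible z' ->
  (forall n, m <= n -> share_vertex (edge_at (prefix_word z n.+1))
                                    (edge_at (prefix_word z' n.+1))) ->
  touch z z'.
Proof.
move=> az az' h n; have [//|nm] := leqP m n; first exact: h.
have := h m (leqnn m); rewrite -(subnK (ltnW nm)); elim: (m - n) => // k IH.
rewrite addSn => /share_vertexP[p p1 p2]; apply: IH.
have [->|ne] := eqVneq (prefix_word z (k + n).+1) (prefix_word z' (k + n).+1).
  exact: share_vertex_refl.
by have [? ?] := shared_by_parents az az' ne p1 p2; apply/share_vertexP; exists p.
Qed.

(** ** Words glued to no other word *)

Definition zigzag (z : nat -> letter) : Prop :=
  forall m, exists2 n, m <= n & z n = r1 /\ z n.+1 = r2.

(** The two ends of the edge reached by the letters r1 r2 are both younger than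
    the edge before these letters, so no vertex of that edge survives; but two
    words that already differ can only share old vertices. *)
Lemma zigzag_touch z z' : admissible z -> admissible z' -> zigzag z ->
  touch z z' -> z = z'.
Proof.
move=> az az' zz t; apply: boolp.funext => k; apply: contrapT => ne.
have ne' n : k < n -> prefix_word z n != prefix_word z' n.
  move=> kn; apply: contra_notN ne => /eqP/(prefix_le kn).
  by rewrite !prefix_wordS => /rcons_inj[].
have [[//|n] kn [z1 z2]] := zz k.+1.
have /share_vertexP[p p1 p2] := t n.+2.
have [q1 q2] := shared_by_parents az az' (ne' _ (leqW kn)) p1 p2.
have [/edge_endP[b pE] _] := shared_by_parents az az' (ne' _ kn) q1 q2.
have := edge_end_size b (az n.+1) (prefix_neq0 _ _).
rewrite -pE size_prefix.
move: p1; rewrite (prefix_wordS _ n.+2) z2 (prefix_wordS _ n.+1) z1.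
have := size_prefix z n.+1; move: (prefix_word z n.+1) => u su.
rewrite !edge_at_rcons !inE /= !name_edge_at => /orP[]/eqP-> /=;
  by rewrite ?size_rcons su; lia.
Qed.

(** ** Words that end at a vertex *)

(** The letters that follow the given end of an edge of the given colour: every
    further edge has that vertex as an end. *)
Definition end_tail (c : colour) (b : bool) : nat -> letter :=
  match c, b with
  | Red, true => fun=> r2
  | Red, false => fun=> r1
  | Blue, true => fun=> bp
  | Blue, false => fun n => if n is 0 then bm else bp
  end.

Definition end_word (w : word) (b : bool) : nat -> letter :=
  cat_word w (end_tail (edge_colour (edge_at w)) b).

Lemma edge_colour_rcons w c : edge_colour (edge_at (rcons w c)) = letter_colour c.
Proof. by rewrite edge_at_rcons; case: c. Qed.

(** Appending one letter of the tail keeps the vertex and makes the other end of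
    the edge a new vertex. *)
Lemma end_word_step w b : valid w -> w != [::] ->
  exists c b', [/\ valid (rcons w c),
    end_word w b = end_word (rcons w c) b',
    edge_end (edge_at (rcons w c)) b' = edge_end (edge_at w) b &
    (edge_end (edge_at (rcons w c)) (~~ b')).1 = w].
Proof.
move=> vw w0.
have stepE c t t' : t = cat_word [:: c] t' ->
    cat_word w t = cat_word (rcons w c) t'.
  by move=> ->; rewrite -cats1 cat_word_cat.
have h := colour_edge_at w0.
case cE : (edge_colour (edge_at w)); rewrite cE in h; case: b.
- exists r2, true; rewrite wf_rcons vw h edge_at_rcons /end_word.
  rewrite edge_colour_rcons cE /= name_edge_at; split=> //.
  by apply: stepE; apply: boolp.funext => -[].
- exists r1, false; rewrite wf_rcons vw h edge_at_rcons /end_word.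
  rewrite edge_colour_rcons cE /= name_edge_at; split=> //.
  by apply: stepE; apply: boolp.funext => -[].
- exists bp, true; rewrite wf_rcons vw h edge_at_rcons /end_word.
  rewrite edge_colour_rcons cE /= name_edge_at; split=> //.
  by apply: stepE; apply: boolp.funext => -[].
- exists bm, true; rewrite wf_rcons vw h edge_at_rcons /end_word.
  rewrite edge_colour_rcons cE /= name_edge_at; split=> //.
  by apply: stepE; apply: boolp.funext => -[].
Qed.

Lemma end_word_prefix w b k : valid w -> w != [::] ->
  exists w' b', [/\ valid w', size w' = size w + k,
    end_word w b = end_word w' b' &
    edge_end (edge_at w') b' = edge_end (edge_at w) b].
Proof.
move=> vw w0; elim: k => [|k [w' [b' [v' s' e' p']]]].
  by exists w, b; rewrite addn0.
have w'0 : w' != [::] by rewrite -size_eq0 s' addn_eq0 size_eq0 (negbTE w0).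
have [c [b2 [v2 e2 p2 _]]] := end_word_step b' v' w'0.
exists (rcons w' c), b2; split=> //; rewrite ?e' ?p2 //.
by rewrite size_rcons s' addnS.
Qed.

(** The other end of a long prefix was created last, hence it carries the name
    of the preceding prefix. *)
Lemma end_word_ends w b n p : valid w -> w != [::] -> size w <= n ->
  p \in [:: source (edge_at (prefix_word (end_word w b) n.+1));
            target (edge_at (prefix_word (end_word w b) n.+1))] ->
  p = edge_end (edge_at w) b \/ p.1 = prefix_word (end_word w b) n.
Proof.
move=> vw w0 sn.
have [w' [b' [v' s' -> <-]]] := end_word_prefix b (n - size w) vw w0.
rewrite subnKC // in s'.
have w'0 : w' != [::] by rewrite -size_eq0 s' -lt0n (leq_trans _ sn) // lt0n size_eq0.
have [c [b2 [v2 -> <- q]]] := end_word_step b' v' w'0.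
have -> : prefix_word (end_word (rcons w' c) b2) n.+1 = rcons w' c.
  by rewrite -s' -(size_rcons w' c) prefix_cat_word0.
have -> : prefix_word (end_word (rcons w' c) b2) n = w'.
  by rewrite -s' /end_word -cats1 cat_word_cat prefix_cat_word0.
case/edge_endP => b3 ->; have [->|] := eqVneq b3 b2; first by left.
move=> nb; right; have -> // : b3 = ~~ b2.
by move: nb; case: (b3); case: (b2).
Qed.

Lemma end_word_end w b n : valid w -> w != [::] -> size w <= n ->
  edge_end (edge_at w) b \in
    [:: source (edge_at (prefix_word (end_word w b) n));
        target (edge_at (prefix_word (end_word w b) n))].
Proof.
move=> vw w0 sn.
have [w' [b' [v' s' -> <-]]] := end_word_prefix b (n - size w) vw w0.
rewrite subnKC // in s'; rewrite -{1 2}s' prefix_cat_word0.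
by apply/edge_endP; exists b'.
Qed.

Lemma end_word_admissible w b : valid w -> w != [::] ->
  admissible (end_word w b).
Proof.
move=> vw w0 n; apply: (@admissible_le _ _ (size w + n)); first exact: leq_addl.
have [w' [b' [v' s' -> _]]] := end_word_prefix b n vw w0.
by rewrite -s' prefix_cat_word0.
Qed.

(** Two long prefixes share either the old vertices at which the words end, which
    are then equal, or vertices created last; the latter carry the names of the
    prefixes, so that the words coincide. *)
Lemma touch_end_word w b w' b' : valid w -> w != [::] -> valid w' -> w' != [::] ->
  touch (end_word w b) (end_word w' b') <->
  edge_end (edge_at w) b = edge_end (edge_at w') b'.
Proof.
move=> vw w0 vw' w'0; split=> [t|e]; last first.
  apply: (@touch_large _ _ (size w + size w')); try exact: end_word_admissible.
  move=> n h; apply/share_vertexP; exists (edge_end (edge_at w) b).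
    by apply: end_word_end => //; lia.
  by rewrite e; apply: end_word_end => //; lia.
have s := edge_end_size b vw w0; have s' := edge_end_size b' vw' w'0.
apply: contrapT => ne.
have pE n : size w + size w' <= n ->
    prefix_word (end_word w b) n = prefix_word (end_word w' b') n.
  move=> h; have /share_vertexP[p p1 p2] := t n.
  have [hn hn'] : size w <= n /\ size w' <= n by lia.
  have [] := end_word_ends vw w0 hn p1; have [] := end_word_ends vw' w'0 hn' p2.
  - by move=> -> /esym/ne.
  - move=> + pE; rewrite pE => /(congr1 size); rewrite size_prefix => sE.
    by move: s; rewrite sE; lia.
  - move=> -> /(congr1 size); rewrite size_prefix => sE.
    by move: s'; rewrite sE; lia.
  - by move=> <- <-.
have : edge_end (edge_at w) b \in
    [:: source (edge_at (prefix_word (end_word w b) (size w + size w').+1));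
        target (edge_at (prefix_word (end_word w b) (size w + size w').+1))].
  by apply: end_word_end => //; lia.
rewrite pE ?leqnSn // => /(end_word_ends vw' w'0 (leq_addl _ _))[/ne//|].
by move/(congr1 size); rewrite size_prefix => sE; move: s; rewrite sE; lia.
Qed.

(** ** The vertices of degree one *)

Definition tip (v : vertex) : bool :=
  match v.2 with vw | vl | vr => true | _ => false end.

Lemma rcons_neq0 (w : word) c : rcons w c != [::].
Proof. by case: w. Qed.

(** Tips are created as targets of blue edges, and only the replacement of a blue
    edge at its target, by b_+, keeps them in that position. *)
Lemma tip_end w b : valid w -> w != [::] -> tip (edge_end (edge_at w) b) ->
  b /\ edge_colour (edge_at w) = Blue.
Proof.
elim/last_ind: w b => // w c IH b vw _; rewrite edge_colour_rcons.
have [w0|w0] := eqVneq w [::].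
  by move: vw; rewrite w0; case: c => //; case: b.
have {}IH b' := IH b' (valid_rcons_inv vw) w0.
have := colour_edge_at w0; move: vw; rewrite wf_rcons => /andP[_ /eqP<-].
rewrite edge_at_rcons.
case: c => //= cE; case: b => //= h; first [by split
  | by case: (IH false h) | by case: (IH true h) => _ hc; move: cE; rewrite hc].
Qed.

(** Going back from an edge at a tip, each step either removes b_+ or reaches the
    edge that created the tip, so that nothing can be chosen. *)
Lemma tip_unique w b w' b' : valid w -> valid w' -> w != [::] ->
  size w = size w' -> tip (edge_end (edge_at w) b) ->
  edge_end (edge_at w) b = edge_end (edge_at w') b' -> w = w'.
Proof.
elim/last_ind: w b w' b' => // w c IH b w' b' vw + _.
elim/last_ind: w' => [_|w' c' _]; first by rewrite size_rcons.
move=> vw'; rewrite !size_rcons => -[sw] tp e.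
have tp' := tp; rewrite e in tp'.
have [bT cB] := tip_end vw (rcons_neq0 _ _) tp.
have [b'T cB'] := tip_end vw' (rcons_neq0 _ _) tp'.
case: b bT tp e => // _ tp e; case: b' b'T tp' e => // _ tp' e.
have [w0|w0] := eqVneq w [::].
  have w'0 : w' = [::] by apply: size0nil; rewrite -sw w0.
  move: vw vw' e; rewrite w0 w'0.
  by case: (c) => //; case: (c') => //; rewrite /edge_at.
have w'0 : w' != [::] by rewrite -size_eq0 -sw size_eq0.
have ss := edge_end_size true (valid_rcons_inv vw) w0.
have ss' := edge_end_size true (valid_rcons_inv vw') w'0.
have tt := @tip_end w false (valid_rcons_inv vw) w0.
have tt' := @tip_end w' false (valid_rcons_inv vw') w'0.
have {}IH := IH true w' true (valid_rcons_inv vw) (valid_rcons_inv vw') w0 sw.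
move: cB cB' tp tp' e; rewrite !edge_colour_rcons !edge_at_rcons.
move: vw vw'; rewrite !wf_rcons => /andP[_ /eqP gw] /andP[_ /eqP gw'].
have gn : grows_on c <> None by rewrite gw (colour_edge_at w0).
have gn' : grows_on c' <> None by rewrite gw' (colour_edge_at w'0).
case: c gn {gw} => //= _ _; case: c' gn' {gw'} => //= _ _.
all: rewrite ?name_edge_at => tp tp' e.
all: try by case: (tt tp).
all: try by case: (tt' tp').
- by case: e => ->.
- by move: ss'; rewrite /= -e /= sw ltnn.
- by move: ss; rewrite /= e /= sw ltnn.
- by rewrite (IH tp e).
Qed.

Lemma tip_touch w b z : valid w -> w != [::] -> tip (edge_end (edge_at w) b) ->
  admissible z -> touch (end_word w b) z -> z = end_word w b.
Proof.
move=> vw w0 tp az t; apply/esym/prefix_inj.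
suff large n : size w <= n ->
    prefix_word (end_word w b) n = prefix_word z n.
  by move=> n; apply: (@prefix_le _ _ _ (size w + n)); rewrite ?leq_addl // large // leq_addr.
move=> sn; have ss := edge_end_size b vw w0.
have n0 : 0 < n by rewrite (leq_trans _ sn) // lt0n size_eq0.
have /share_vertexP[p p1 p2] := t n.
have := p1; case/(end_word_ends vw w0 sn) => [pE|pE].
  suff : prefix_word (end_word w b) n.+1 = prefix_word z n.+1.
    by move/prefix_le; apply.
  case/edge_endP: p1 => b1 e1; case/edge_endP: p2 => b2 e2.
  apply: (@tip_unique _ b1 _ b2); rewrite ?size_prefix ?prefix_neq0 -?e1 -?e2 ?pE //.
  exact: end_word_admissible.
case/edge_endP: p2 => b2 e2; have := pE; rewrite e2.
have := az n.+1; rewrite prefix_wordS => vz.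
have pn0 : prefix_word z n != [::] by rewrite -size_eq0 size_prefix -lt0n.
have [[b3 ->]|->//] := edge_end_rcons b2 vz pn0.
have := edge_end_size b3 (az n) pn0 => + /(congr1 size) sE.
by rewrite sE !size_prefix ltnn.
Qed.

(** Each vertex that is not a tip is created as an end of a red edge, except a and
    b, which are ends of the red base edges. *)
Lemma red_end w b : valid w -> w != [::] -> ~~ tip (edge_end (edge_at w) b) ->
  exists w' b', [/\ valid w', w' != [::], edge_colour (edge_at w') = Red &
    edge_end (edge_at w') b' = edge_end (edge_at w) b].
Proof.
elim/last_ind: w b => // w c IH b vw _.
have [w0|w0] := eqVneq w [::].
  rewrite w0 /= => nt.
  have : edge_end (edge_at [:: c]) b = ([::], va) \/
         edge_end (edge_at [:: c]) b = ([::], vb).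
    by move: vw nt; rewrite w0; case: c => //; case: b => //; auto.
  by case=> ->; [exists [:: eD], false|exists [:: eD], true].
have {}IH b' := IH b' (valid_rcons_inv vw) w0.
have gw : grows_on c = Some (edge_colour (edge_at w)).
  by move: vw; rewrite wf_rcons (colour_edge_at w0) => /andP[_ /eqP].
have nv d : grows_on d = grows_on c -> valid (rcons w d).
  by move=> gd; rewrite wf_rcons (valid_rcons_inv vw) gd gw (colour_edge_at w0) eqxx.
have := edge_end_rcons b vw w0; rewrite edge_at_rcons.
case=> [[b' ->]|]; first exact: IH.
move=> nE nt.
have : [\/ grows_on c = Some Red /\ edge_end (child (edge_at w) c) b = (w, vm),
           grows_on c = Some Blue /\ edge_end (child (edge_at w) c) b = (w, vx) |
           grows_on c = Some Blue /\ edge_end (child (edge_at w) c) b = (w, vy)].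
  have sz b' := edge_end_size b' (valid_rcons_inv vw) w0.
  move: nE nt; rewrite /child name_edge_at.
  case: c gw {nv vw} => //= gw; case: b => //= nE //= nt;
    try by [apply: Or31|apply: Or32|apply: Or33];
    by have := sz true; have := sz false; rewrite /= nE ltnn.
case=> -[gc ->].
- by exists (rcons w r1), true; rewrite nv ?gc // edge_at_rcons /= name_edge_at rcons_neq0.
- by exists (rcons w ed), false; rewrite nv ?gc // edge_at_rcons /= name_edge_at rcons_neq0.
- by exists (rcons w ed), true; rewrite nv ?gc // edge_at_rcons /= name_edge_at rcons_neq0.
Qed.

(** Tails over red edges consist of r1 and r2, tails over blue edges do not. *)
Lemma end_word_colour w b w' b' : end_word w b = end_word w' b' ->
  edge_colour (edge_at w) = edge_colour (edge_at w').
Proof.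
move=> e.
have h v a : end_word v a (size w + size w').+1.+1 =
    end_tail (edge_colour (edge_at v)) a ((size w + size w').+2 - size v) \/
    size w + size w' < size v.
  rewrite /end_word /cat_word; case: ltnP => hh; last by left.
  by right; lia.
have := congr1 (fun f => f (size w + size w').+2) e => /=.
have [->|] := h w b; last lia; have [->|] := h w' b'; last lia.
have [-> ->] : (size w + size w').+2 - size w = (size w').+2 /\
               (size w + size w').+2 - size w' = (size w).+2 by lia.
by case: (edge_colour _); case: (edge_colour _); case: b {e h}; case: b'.
Qed.

(** * Points of the limit space and canonical maps *)

Lemma Omega_end_word : Omega (end_word [:: eU] true).
Proof. by apply/admissible_Omega; exact: end_word_admissible. Qed.

(** Total on all sequences of letters, so that statements need not carry proofs
    of admissibility; it is the class of the word when the word is admissible. *)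
Definition point (z : nat -> letter) : airplane :=
  airplane_class (insubd (SigSub (mem_set Omega_end_word) : Omega) z).

Lemma pointE (z : Omega) : airplane_class z = point (val z).
Proof. by rewrite /point valKd. Qed.

Lemma admissible_val (z : Omega) : admissible (val z).
Proof. by apply/admissible_Omega; exact: set_mem (valP z). Qed.

Lemma val_admissible z : admissible z -> exists z' : Omega, val z' = z.
Proof.
by move=> /admissible_Omega Oz; exists (SigSub (mem_set Oz)).
Qed.

Lemma point_surj a : exists2 z, admissible z & a = point z.
Proof.
exists (val (repr (a : {eq_quot gluing_equiv}))); first exact: admissible_val.
by rewrite -pointE /airplane_class reprK.
Qed.

Lemma glued_touch (z z' : Omega) : glued z z' <-> touch (val z) (val z').
Proof.
have az := admissible_val z; have az' := admissible_val z'.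
split=> [g n|t n].
  have [e [f [/full_expansion_edge_at[_ _ ->] /full_expansion_edge_at[_ _ ->]]]]
    := g n.
  by rewrite !name_edge_at => -> ->.
exists (edge_at (prefix_word (val z) n.+1)), (edge_at (prefix_word (val z') n.+1)).
have fe y : admissible y -> edge_at (prefix_word y n.+1) \in full_expansion n.
  move=> ay; have := edge_at_full_expansion (ay n.+1) (prefix_neq0 y n).
  by rewrite size_prefix.
by rewrite !name_edge_at; split=> //; apply: fe.
Qed.

Lemma point_eq z z' : admissible z -> admissible z' ->
  point z = point z' <-> touch z z'.
Proof.
move=> /val_admissible[y <-] /val_admissible[y' <-]; rewrite -!pointE.
rewrite -glued_touch; split=> [/eqmodP/asboolP//|g].
by apply/eqmodP/asboolP.
Qed.

Lemma zigzag_point z z' : admissible z -> admissible z' -> zigzag z ->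
  point z = point z' -> z = z'.
Proof. by move=> az az' zz /(point_eq az az'); exact: zigzag_touch. Qed.

(** A tail for an edge of the given colour. The flag selects the first letter, so
    that every edge is continued by two words glued to no other word which differ
    at once. *)
Definition zig (c : colour) (b : bool) : nat -> letter := fun n =>
  if n is 0 then
    match c, b with Red, true => r1 | Red, false => r2
                  | Blue, true => eu | Blue, false => ed end
  else if odd n then r1 else r2.

Lemma wf_zig c b n : wf (Some c) (prefix_word (zig c b) n).
Proof.
suff : wf (Some c) (prefix_word (zig c b) n) /\
    last_colour (Some c) (prefix_word (zig c b) n) = Some (if n is 0 then c else Red).
  by case.
elim: n => [//|n [IH1 IH2]]; rewrite prefix_wordS wf_rcons last_colour_rcons.
rewrite IH1 IH2 /zig; case: n {IH1 IH2} => [|n]; first by case: c; case: b.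
by case: odd.
Qed.

Definition zig_word (w : word) (b : bool) : nat -> letter :=
  cat_word w (zig (edge_colour (edge_at w)) b).

Lemma admissible_zig_word w b : valid w -> w != [::] -> admissible (zig_word w b).
Proof.
move=> vw w0; apply/admissible_cat; split=> // n.
by rewrite (colour_edge_at w0) wf_zig.
Qed.

Lemma cat_word_add v x k : cat_word v x (size v + k) = x k.
Proof. by rewrite /cat_word ltnNge leq_addr /= addKn. Qed.

Lemma zigzag_cat w x : zigzag x -> zigzag (cat_word w x).
Proof.
move=> zx m; have [n mn [x1 x2]] := zx m; exists (size w + n).
  by rewrite (leq_trans mn) ?leq_addl.
by rewrite -addnS !cat_word_add.
Qed.

Lemma zigzag_zig c b : zigzag (zig c b).
Proof. by move=> m; exists m.*2.+1; [lia|rewrite /= odd_double]. Qed.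

Lemma zigzag_zig_word w b : zigzag (zig_word w b).
Proof. exact/zigzag_cat/zigzag_zig. Qed.

Definition twin (w w' : word) : Prop :=
  [/\ valid w, w != [::], valid w', w' != [::] &
      edge_colour (edge_at w) = edge_colour (edge_at w')].

Definition canonical_on (f : airplane -> airplane) (w w' : word) : Prop :=
  twin w w' /\ forall x, admissible (cat_word w x) ->
    f (point (cat_word w x)) = point (cat_word w' x).

Lemma twin_sym w w' : twin w w' -> twin w' w.
Proof. by case. Qed.

Lemma twin_admissible w w' x : twin w w' ->
  admissible (cat_word w x) -> admissible (cat_word w' x).
Proof.
case=> vw w0 vw' w'0 c /admissible_cat[_ h]; apply/admissible_cat; split=> // n.
by rewrite (colour_edge_at w'0) -c -(colour_edge_at w0).
Qed.

Lemma twin_cat w w' u : twin w w' -> valid (w ++ u) -> twin (w ++ u) (w' ++ u).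
Proof.
case=> vw w0 vw' w'0 c vu.
have ne (a b : word) : a != [::] -> a ++ b != [::] by case: a.
have cu : last_colour None w = last_colour None w'.
  by rewrite (colour_edge_at w0) (colour_edge_at w'0) c.
split=> //; try exact: ne.
  by move: vu; rewrite !wf_cat vw' -cu => /andP[].
have := last_colour_cat None w u; have := last_colour_cat None w' u.
by rewrite cu => <-; rewrite !colour_edge_at ?ne // => -[].
Qed.

Lemma twin_last_colour w w' : twin w w' -> last_colour None w = last_colour None w'.
Proof. by case=> _ w0 _ w'0 c; rewrite !colour_edge_at // c. Qed.

Lemma canonical_restricts f e e' : is_edge e -> is_edge e' ->
  restricts_to_canonical f e e' <-> canonical_on f (name e) (name e').
Proof.
move=> /is_edge_edge_at[ve e0 eE] /is_edge_edge_at[ve' e'0 e'E].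
split=> [[c h]|[[_ _ _ _]]].
  have tw : twin (name e) (name e') by split=> //; rewrite -eE -e'E.
  split=> // x ax.
  have [z zE] := val_admissible ax.
  have [z' z'E] := val_admissible (twin_admissible tw ax).
  by rewrite -zE -z'E -!pointE; apply: h zE z'E.
rewrite -eE -e'E => c h; split=> // x z z' zE z'E.
by rewrite !pointE zE z'E h // -zE; exact: admissible_val.
Qed.

Lemma canonical_cat f w w' u : canonical_on f w w' -> valid (w ++ u) ->
  canonical_on f (w ++ u) (w' ++ u).
Proof.
move=> [tw h] vu; split; first exact: twin_cat.
by move=> x; rewrite !cat_word_cat; exact: h.
Qed.

(** An image word that extended another one by u would satisfy x = u x for the two
    zigzag tails x, whose first letters differ; hence u is empty. *)
Lemma canonical_unique f w a b :
  canonical_on f w a -> canonical_on f w b -> a = b.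
Proof.
wlog : a b / size a <= size b.
  by move=> W fa fb; have [/W|/ltnW/W h] := leqP (size a) (size b);
    [exact|exact/esym/h].
move=> ab fa fb; have [[vw w0 va a0 ca] _] := fa; have [[_ _ vb b0 cb] _] := fb.
have key i : zig_word a i = zig_word b i.
  apply: zigzag_point; rewrite /zig_word; try exact: admissible_zig_word.
    exact: zigzag_zig_word.
  have az := admissible_zig_word i vw w0.
  by rewrite -ca -cb -fa.2 // -fb.2.
have [u bE uE] := prefixes_comparable (key true) ab.
have [u' bE' uE'] := prefixes_comparable (key false) ab.
have uu : u' = u.
  by have /eqP := bE'; rewrite bE eqseq_cat // eqxx => /eqP ->.
case: u uu bE uE => [|c u] uu bE uE; first by rewrite bE cats0.
have := congr1 (fun f => f 0) uE; have := congr1 (fun f => f 0) uE'.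
rewrite uu /cat_word /= => <-.
by case: (edge_colour _).
Qed.

Lemma canonical_unique_cat f w w' u w2 : canonical_on f w w' ->
  canonical_on f (w ++ u) w2 -> w2 = w' ++ u.
Proof.
move=> fw fu; have [[vu _ _ _ _] _] := fu.
exact: canonical_unique fu (canonical_cat fw vu).
Qed.

Lemma canonical_comp f g w w' w'' : canonical_on g w w' ->
  canonical_on f w' w'' -> canonical_on (f \o g) w w''.
Proof.
move=> [tw hg] [tw' hf]; split; last first.
  by move=> x ax /=; rewrite hg // hf //; exact: twin_admissible ax.
by case: tw tw' => ? ? _ _ cw [_ _ ? ? cw']; split=> //; rewrite cw.
Qed.

Lemma canonical_inv f g w w' : cancel f g -> canonical_on f w w' ->
  canonical_on g w' w.
Proof.
move=> fK [tw h]; split; first exact: twin_sym.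
move=> x ax; have {}ax := twin_admissible (twin_sym tw) ax.
by rewrite -h // fK.
Qed.

(** * Rearrangements act by prefix exchange at some level *)

Definition level_words (n : nat) : seq word :=
  [seq name e | e <- full_expansion n].

Lemma mem_level_words n w :
  (w \in level_words n) = valid w && (size w == n.+1).
Proof.
apply/mapP/andP => [[e /full_expansion_edge_at[ve se _] ->]|[vw /eqP sw]].
  by rewrite ve se.
have w0 : w != [::] by rewrite -size_eq0 sw.
exists (edge_at w); last by rewrite name_edge_at.
by have := edge_at_full_expansion vw w0; rewrite sw.
Qed.

Definition canonical_at (f : airplane -> airplane) (n : nat) : Prop :=
  forall w, valid w -> n < size w -> exists w', canonical_on f w w'.

(** For words glued to no other word, lying in a cell is a matter of prefixes. *)
Lemma cell_zig_word e w b : is_edge e -> valid w -> w != [::] ->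
  cell e (point (zig_word w b)) ->
  prefix_word (zig_word w b) (size (name e)) = name e.
Proof.
move=> ee vw w0 [z /= zE]; rewrite pointE => pE.
rewrite (@zigzag_point (zig_word w b) (val z)) //.
- exact: admissible_zig_word.
- exact: admissible_val.
- exact: zigzag_zig_word.
Qed.

Lemma rearrangement_canonical_at f : rearrangement f -> exists n, canonical_at f n.
Proof.
case=> P [Pe Pc _] Pf; exists (\max_(e <- P) size (name e)) => w vw wP.
have w0 : w != [::] by rewrite -size_eq0 -lt0n (leq_trans _ wP).
have : setT (point (zig_word w true)) by [].
rewrite -Pc => -[e /= eP ez].
have [e' ee' /(canonical_restricts _ (Pe _ eP) ee') fe] := Pf _ eP.
have pe := cell_zig_word (Pe _ eP) vw w0 ez.
have ew : size (name e) <= size w.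
  apply: ltnW; apply: leq_trans wP; rewrite ltnS.
  by rewrite (big_rem e) //= leq_maxl.
have : cat_word (name e) (fun k => zig_word w true (size (name e) + k)) =
    cat_word w (zig (edge_colour (edge_at w)) true).
  by rewrite -{1}pe cat_word_shift.
case/prefixes_comparable/(_ ew) => u wE _.
by exists (name e' ++ u); rewrite wE; apply: canonical_cat; rewrite -?wE.
Qed.

(** If no prefix of z were long enough, words outside the open set that agree with
    z on longer and longer prefixes would converge to z. *)
Lemma open_Omega_cylinder (W : set Omega) (z : Omega) : open W -> W z ->
  exists n, forall z' : Omega,
    prefix_word (val z') n = prefix_word (val z) n -> W z'.
Proof.
move=> oW Wz; have [V oV VE] : exists2 V : set symbols, open V & val @^-1` V = W.
  exact: oW.
have Vz : V (val z) by move: Wz; rewrite -VE.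
apply: contrapT => nex.
have pick n : exists z' : Omega,
    prefix_word (val z') n = prefix_word (val z) n /\ ~ V (val z').
  apply: contrapT => h; apply: nex; exists n => z' e.
  by rewrite -VE /=; apply: contrapT => nV; apply: h; exists z'.
have [u uP] := boolp.choice pick.
have cu : (fun n => val (u n) : symbols) @ \oo --> (val z : symbols).
  apply/cvg_sup => i A.
  rewrite nbhsE => -[B [[C oC <-] /= Cz] sub]; rewrite nbhs_simpl /=.
  exists i.+1 => // n /= hn; apply: sub; rewrite /=.
  have := prefix_le hn (uP n).1; rewrite !prefix_wordS => /rcons_inj[_].
  by rewrite /proj /= => ->.
have := cu V (open_nbhs_nbhs (conj oV Vz)).
by case=> n _ /(_ n (leqnn n)) /=; apply: (uP n).2.
Qed.

(** A common interior point of two cells would have a zigzag word near it that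
    lies in both cells, hence has both names as prefixes. *)
Lemma full_expansion_cellular n : cellular_partition (full_expansion n).
Proof.
have is_e e : e \in full_expansion n -> is_edge e.
  case/full_expansion_edge_at => ve se ->; apply: edge_at_is_edge => //.
  by rewrite -size_eq0 se.
split=> // [|e e' en e'n ne].
  apply/seteqP; split=> // a _; have [z az ->] := point_surj a.
  have [y yE] := val_admissible az.
  exists (edge_at (prefix_word z n.+1)) => /=.
    by have := edge_at_full_expansion (az n.+1) (prefix_neq0 _ _); rewrite size_prefix.
  exists y; rewrite ?pointE ?yE //=.
  by rewrite name_edge_at size_prefix -yE.
apply/seteqP; split=> // a [ae ae'].
have [z az aE] := point_surj a; have [y yE] := val_admissible az.
pose W := [set z : Omega | ((cell e)° `&` (cell e')°) (airplane_class z)].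
have oW : open W.
  have := @pi_continuous _ {eq_quot gluing_equiv}; move/continuousP; apply.
  by apply: openI; exact: open_interior.
have Wy : W y by rewrite /W /= pointE yE -aE.
have [k kW] := open_Omega_cylinder oW Wy.
pose w := prefix_word z (maxn k n).+1.
have w0 : w != [::] by exact: prefix_neq0.
have vw : valid w by exact: az.
have [t tE] := val_admissible (admissible_zig_word true vw w0).
have Wt : W t.
  apply: kW; rewrite tE yE; apply: (@prefix_le _ _ _ (maxn k n).+1).
    by rewrite leqW // leq_maxl.
  by rewrite -{1}(size_prefix z (maxn k n).+1) prefix_cat_word0.
have [/interior_subset + /interior_subset] := Wt.
rewrite pointE tE => /(cell_zig_word (is_e _ en) vw w0).
move=> + /(cell_zig_word (is_e _ e'n) vw w0).
rewrite (full_expansion_size en) (full_expansion_size e'n) => -> ee.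
by case/eqP: ne; exact: full_expansion_inj en e'n ee.
Qed.

Lemma canonical_at_rearrangement (f : homeo airplane) n :
  canonical_at f n -> rearrangement f.
Proof.
move=> fn; exists (full_expansion n); first exact: full_expansion_cellular.
move=> e en; have [ve se eE] := full_expansion_edge_at en.
have [|w' fw'] := fn _ ve; first by rewrite se.
have [[_ e0 vw' w'0 _] _] := fw'.
exists (edge_at w'); first exact: edge_at_is_edge.
apply/canonical_restricts; rewrite ?name_edge_at //; last exact: edge_at_is_edge.
by rewrite eE; exact: edge_at_is_edge.
Qed.

(** The images of the words of a given length form a complete code: a zigzag word
    over g is the image of a word, and being glued to no other word it starts with
    the image of a prefix of that word. *)
Lemma canonical_image (f : homeo airplane) n : canonical_at f n ->
  exists (F : word -> word) (m : nat),
    [/\ forall w, w \in level_words n -> canonical_on f w (F w),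
        forall w, w \in level_words n -> size (F w) <= m &
        forall g, valid g -> m < size g ->
          exists w u, w \in level_words n /\ g = F w ++ u].
Proof.
move=> fn; have /boolp.choice[F FP] w : exists w',
    w \in level_words n -> canonical_on f w w'.
  have [|] := boolP (w \in level_words n); last by exists [::].
  rewrite mem_level_words => /andP[vw /eqP sw].
  by have [|w'] := fn w vw; [rewrite sw|exists w'].
exists F, (\max_(w <- level_words n) size (F w)).
have Fm w : w \in level_words n ->
    size (F w) <= \max_(w <- level_words n) size (F w).
  by move=> wn; rewrite (big_rem w) //= leq_maxl.
split=> // g vg gm.
have g0 : g != [::] by rewrite -size_eq0 -lt0n (leq_trans _ gm).
have [y ay yE] := point_surj (homeo_inv f (point (zig_word g true))).
have wn : prefix_word y n.+1 \in level_words n.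
  by rewrite mem_level_words ay size_prefix eqxx.
have [tw fw] := FP _ wn; set w := prefix_word y n.+1 in wn tw fw.
pose x k := y (n.+1 + k); have yx : y = cat_word w x by rewrite cat_word_shift.
have : zig_word g true = cat_word (F w) x.
  apply: zigzag_point; [exact: admissible_zig_word|..|exact: zigzag_zig_word|].
    by apply: twin_admissible tw _; rewrite -yx.
  by rewrite -fw -?yx // -yE homeo_invK.
move/esym/prefixes_comparable => [|u gE _]; last by exists w, u.
by apply: ltnW; apply: leq_trans gm; rewrite ltnS Fm.
Qed.

Lemma canonical_at_inv (f : homeo airplane) n : canonical_at f n ->
  exists m, canonical_at (homeo_inv f) m.
Proof.
move=> fn; have [F [m [FP _ Fc]]] := canonical_image fn.
exists m => g vg gm; have [w [u [wn gE]]] := Fc g vg gm.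
exists (w ++ u); rewrite gE; apply: canonical_cat; last by rewrite -gE.
by apply: canonical_inv (FP _ wn); exact: homeoK.
Qed.

Lemma canonical_pair f g n m w : canonical_at f n -> canonical_at g m ->
  valid w -> m + n < size w ->
  exists w' w'', canonical_on g w w' /\ canonical_on f w' w''.
Proof.
move=> fn gm vw sw; rewrite -(cat_take_drop m.+1 w) in vw *.
have mw : m.+1 <= size w by lia.
have su : size (drop m.+1 w) = size w - m.+1 := size_drop _ _.
have sa : size (take m.+1 w) = m.+1 := size_takel mw.
move: (take m.+1 w) (drop m.+1 w) su sa vw => a u su sa vw.
have va : valid a by move: vw; rewrite wf_cat => /andP[].
have [|a' ga] := gm a va; first by rewrite sa.
have gau := canonical_cat ga vw; have [[_ _ va'u _ _] _] := gau.
have [|b fb] := fn _ va'u; last by exists (a' ++ u), b.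
have [[_ _ _ + _] _] := ga; rewrite -size_eq0 size_cat su.
by move: (size a') => j; lia.
Qed.

Lemma canonical_at_comp f g n m : canonical_at f n -> canonical_at g m ->
  canonical_at (f \o g) (m + n).
Proof.
move=> fn gm w vw sw; have [w' [w'' [gw fw]]] := canonical_pair fn gm vw sw.
by exists w''; exact: canonical_comp fw.
Qed.

Lemma canonical_id w : valid w -> w != [::] -> canonical_on id w w.
Proof. by move=> vw w0; split. Qed.

Lemma T_A_canonical_at (f : homeo airplane) :
  T_A f <-> exists n, canonical_at f n.
Proof.
split; first exact: rearrangement_canonical_at.
by case=> n; exact: canonical_at_rearrangement.
Qed.

Lemma T_A_subgroup : is_subgroup T_A.
Proof.
split=> [|f g]; rewrite !inE.
  apply/T_A_canonical_at; exists 0 => w vw w0.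
  by exists w; apply: canonical_id; rewrite // -size_eq0 -lt0n.
move=> /T_A_canonical_at[n fn] /T_A_canonical_at[m gm].
have [k gk] := canonical_at_inv gm.
by apply/T_A_canonical_at; exists (k + n); exact: canonical_at_comp gk.
Qed.

(** * Arcs of the circle *)

(** [Whole] is the whole circle, the only arc over the empty word. *)
Inductive arc := Whole | Rim | Out | Back.

Definition arc_code (t : arc) : option (option bool) :=
  match t with Whole => None | Rim => Some None | Out => Some (Some true)
             | Back => Some (Some false) end.
Definition arc_decode (o : option (option bool)) : arc :=
  match o with None => Whole | Some None => Rim | Some (Some true) => Out
             | Some (Some false) => Back end.

Lemma arc_codeK : cancel arc_code arc_decode.
Proof. by case. Qed.

HB.instance Definition _ := Countable.copy arc (can_type arc_codeK).

Definition borders (t : arc) (o : option colour) : bool :=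
  match o, t with
  | None, Whole | Some Red, Rim | Some Blue, Out | Some Blue, Back => true
  | _, _ => false
  end.

(** The kind of the arc that contains the arc [t] over the edge [c] of a
    replacement graph. The walk runs through b_- against its direction, which
    exchanges [Out] and [Back]. An arc determines the arcs that contain it, while
    an arc contains several, or no, arcs over a given smaller edge; this is why
    arcs are followed from the end of a word to its beginning. *)
Definition outer (c : letter) (t : arc) : arc :=
  match c with
  | eL | eR | eU | eD => Whole
  | r1 | r2 | bs => Rim
  | ed => Out
  | eu => Back
  | bp => t
  | bm => match t with Out => Back | Back => Out | _ => t end
  end.

Fixpoint first_arc (t : arc) (w : word) : arc :=
  if w is c :: v then outer c (first_arc t v) else t.

Lemma first_arc_cat t v w : first_arc t (v ++ w) = first_arc (first_arc t w) v.
Proof. by elim: v => //= c v ->. Qed.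

Lemma borders_outer c t o : borders t (Some (letter_colour c)) ->
  grows_on c = o -> borders (outer c t) o.
Proof. by move=> + <-; case: c => //; case: t. Qed.

Lemma borders_first t o w : wf o w -> borders t (last_colour o w) ->
  borders (first_arc t w) o.
Proof.
elim: w o => //= c w IH o /andP[/eqP gc cw] tw.
exact: borders_outer (IH _ cw tw) gc.
Qed.

Lemma borders_whole t : borders t None -> t = Whole.
Proof. by case: t. Qed.

(** The arc [t] over [c] is followed by the arc [t'] over [c'] in the arc that
    contains both; the circle closes up from the last arc to the first. *)
Definition next (c : letter) (t : arc) (c' : letter) (t' : arc) : bool :=
  match c, t, c', t' with
  | eL, Out, eL, Back | eL, Back, eD, Rim | eD, Rim, eR, Out
  | eR, Out, eR, Back | eR, Back, eU, Rim | eU, Rim, eL, Out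
  | r1, Rim, bs, Out | bs, Out, bs, Back | bs, Back, r2, Rim
  | bm, Back, ed, Rim | ed, Rim, bp, Out
  | bp, Back, eu, Rim | eu, Rim, bm, Out => true
  | _, _, _, _ => false
  end.

(** With [true] for the end of an arc and [false] for its beginning: is it the
    target of the edge? *)
Definition end_side (t : arc) (b : bool) : bool := if t is Back then ~~ b else b.

Definition corner (w : word) (t : arc) (b : bool) : vertex :=
  edge_end (edge_at w) (end_side t b).

(** At a vertex of degree three the walk passes twice, once from a red edge to a
    blue one and once back. This bit tells the passages apart: it is true at the
    end of a red arc and at the beginning of a blue one. *)
Definition leaves_rim (t : arc) (b : bool) : bool := if t is Rim then b else ~~ b.

Lemma next_corner p c t c' t' : next c t c' t' ->
  borders t (Some (letter_colour c)) -> borders t' (Some (letter_colour c')) ->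
  corner (rcons p c) t true = corner (rcons p c') t' false /\
  (leaves_rim t true = leaves_rim t' false \/ tip (corner (rcons p c) t true)).
Proof.
rewrite /corner !edge_at_rcons.
case: c => //; case: t => // nx _; case: c' nx => //; case: t' => //= _ _;
  split=> //; by [left|right].
Qed.

Section Circle.
Variable R : realType.
Local Open Scope ring_scope.

(** Positions and lengths are in eighths of the arc [outer c t]. They are chosen
    so that every division of an arc arises by successive halving. *)
Definition offset8 (c : letter) (t : arc) : nat :=
  match c, t with
  | eL, Back => 1 | eD, _ => 2 | eR, Back => 5 | eR, _ => 4 | eU, _ => 6
  | bs, Back => 4 | bs, _ => 2 | r2, _ => 6
  | eu, _ | ed, _ => 2
  | bm, Out | bp, Out => 4
  | _, _ => 0
  end.

Definition width8 (c : letter) (t : arc) : nat :=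
  match c, t with
  | eL, _ | eR, _ => 1
  | bm, Out | bp, Out => 4
  | _, _ => 2
  end.

Lemma eighths_bound c t : borders t (Some (letter_colour c)) ->
  (offset8 c t + width8 c t <= 8)%N.
Proof. by case: c => //; case: t. Qed.

Lemma eighths_meet c t c' t' :
  borders t (Some (letter_colour c)) -> borders t' (Some (letter_colour c')) ->
  outer c t = outer c' t' -> (c, t) <> (c', t') ->
  ((offset8 c t + width8 c t <= offset8 c' t') &&
     ((offset8 c t + width8 c t == offset8 c' t') ==> next c t c' t'))%N \/
  ((offset8 c' t' + width8 c' t' <= offset8 c t) &&
     ((offset8 c' t' + width8 c' t' == offset8 c t) ==> next c' t' c t))%N.
Proof.
by case: c => //; case: t => //= _; case: c' => //; case: t' => //= _ oE ne;
  try discriminate oE; first [by left | by right | by case: ne].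
Qed.

Lemma eighths_wrap c t c' t' :
  borders t (Some (letter_colour c)) -> borders t' (Some (letter_colour c')) ->
  outer c t = Whole -> outer c' t' = Whole -> offset8 c t = 0%N ->
  (offset8 c' t' + width8 c' t' = 8)%N -> next c' t' c t.
Proof. by case: c => //; case: t => //=; case: c' => //; case: t'. Qed.

Definition eighth (n : nat) : R := n%:R / 8%:R.

Definition inside (c : letter) (t : arc) (s : R) : R :=
  eighth (offset8 c t) + eighth (width8 c t) * s.

(** The position in the arc [first_arc t w] of the point with coordinate [s] in
    the arc [t] over [w]. *)
Fixpoint place (t : arc) (w : word) (s : R) : R :=
  if w is c :: v then inside c (first_arc t v) (place t v s) else s.

Lemma place_cat t v w s : place t (v ++ w) s = place (first_arc t w) v (place t w s).
Proof. by elim: v => //= c v ->; rewrite first_arc_cat. Qed.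

Lemma place_rcons t w c s :
  place t (rcons w c) s = place (outer c t) w (inside c t s).
Proof. by rewrite -cats1 place_cat. Qed.

Lemma width8_bounds c t : 0 < (width8 c t)%:R :> R /\ (width8 c t)%:R <= 4%:R :> R.
Proof. by rewrite ltr0n ler_nat /width8; case: c; case: t. Qed.

Lemma inside_bounds c t s : borders t (Some (letter_colour c)) ->
  0 <= s <= 1 -> 0 <= inside c t s <= 1.
Proof.
move=> /eighths_bound; rewrite -(ler_nat R) natrD /inside /eighth.
have [w0 _] := width8_bounds c t; have : 0 <= (offset8 c t)%:R :> R by [].
move: w0; move: ((offset8 c t)%:R : R) ((width8 c t)%:R : R) => o w w0 o0 h /andP[s0 s1].
by apply/andP; split; nra.
Qed.

Lemma place_bounds o t w s : wf o w -> borders t (last_colour o w) ->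
  0 <= s <= 1 -> 0 <= place t w s <= 1.
Proof.
elim: w o => //= c w IH o /andP[_ cw] tw s01.
apply: inside_bounds; first exact: borders_first cw tw.
exact: IH cw tw s01.
Qed.

Definition span (t : arc) (w : word) : R := place t w 1 - place t w 0.

Lemma place_span t w s : place t w s = place t w 0 + span t w * s.
Proof.
rewrite /span; elim: w => /= [|c w ->]; first by ring.
by rewrite /inside; ring.
Qed.

Lemma span_cons t c w :
  span t (c :: w) = eighth (width8 c (first_arc t w)) * span t w.
Proof. by rewrite /span /= /inside; ring. Qed.

Lemma eighth_width c t : 0 < eighth (width8 c t) <= eighth 4.
Proof.
have [w0 w4] := width8_bounds c t.
by rewrite /eighth divr_gt0 //= ler_pM2r // invr_gt0.
Qed.

Lemma span_gt0 t w : 0 < span t w.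
Proof.
elim: w => [|c w IH]; first by rewrite /span /= subr0.
by rewrite span_cons mulr_gt0 //; case/andP: (eighth_width c (first_arc t w)).
Qed.

Lemma span_lt1 t w : w != [::] -> span t w < 1.
Proof.
have step c v : span t v <= 1 -> span t (c :: v) < 1.
  rewrite span_cons; have := span_gt0 t v.
  have /andP[] := eighth_width c (first_arc t v).
  move: (eighth (width8 _ _)) (span t v) => x y; rewrite /eighth; nra.
case: w => // c w _; apply: (step); elim: w => [|d w IH].
  by rewrite /span /= subr0.
exact/ltW/step.
Qed.

Definition same_place (t : arc) (x y : R) : Prop :=
  x = y \/ t = Whole /\ (x = 0 /\ y = 1 \/ x = 1 /\ y = 0).

Lemma same_place_inj t u w s s' : w != [::] -> 0 <= s <= 1 -> 0 <= s' <= 1 ->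
  same_place u (place t w s) (place t w s') -> s = s'.
Proof.
move=> w0 /andP[s0 s1] /andP[s'0 s'1]; rewrite (place_span t w s) (place_span t w s').
have := span_gt0 t w; have := span_lt1 t w0.
move: (place t w 0) (span t w) => a k k1 k0 [e|[_ [[e e']|[e e']]]].
- by apply: (mulfI (lt0r_neq0 k0)); apply: (addrI a).
- by nra.
- by nra.
Qed.

Lemma inside_consecutive c t c' t' s s' :
  (offset8 c t + width8 c t <= offset8 c' t')%N ->
  0 <= s <= 1 -> 0 <= s' <= 1 -> inside c t s = inside c' t' s' ->
  [/\ s = 1, s' = 0 & (offset8 c t + width8 c t = offset8 c' t')%N].
Proof.
rewrite -(ler_nat R) natrD /inside /eighth => h /andP[s0 s1] /andP[s'0 s'1] e.
have [w0 _] := width8_bounds c t; have [w'0 _] := width8_bounds c' t'.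
suff [-> -> e'] : [/\ s = 1, s' = 0 &
    (offset8 c t)%:R + (width8 c t)%:R = (offset8 c' t')%:R :> R].
  by split=> //; apply/eqP; rewrite -(eqr_nat R) natrD e'.
move: h e w0 w'0; move: ((offset8 c t)%:R : R) ((width8 c t)%:R : R)
  ((offset8 c' t')%:R : R) ((width8 c' t')%:R : R) => o w o' w' h e w0 w'0.
have e2 : o + w * s = o' + w' * s' by lra.
have ws : w * s <= w by nra.
have ws' : 0 <= w' * s' by nra.
split; last by lra.
- by apply: (mulfI (lt0r_neq0 w0)); lra.
- by apply: (mulfI (lt0r_neq0 w'0)); lra.
Qed.

Lemma inside_end_eighths c t s (b : bool) : borders t (Some (letter_colour c)) ->
  0 <= s <= 1 -> inside c t s = b%:R ->
  s = b%:R /\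
  (if b then offset8 c t + width8 c t == 8 else offset8 c t == 0)%N.
Proof.
move=> /eighths_bound; rewrite -(ler_nat R) natrD /inside /eighth.
move=> h /andP[s0 s1] e.
have [w0 _] := width8_bounds c t; have o0 : 0 <= (offset8 c t)%:R :> R by [].
rewrite -!(eqr_nat R) natrD.
move: h e w0 o0; move: ((offset8 c t)%:R : R) ((width8 c t)%:R : R) => o w h e w0 o0.
have ws : w * s <= w by nra.
have ws' : 0 <= w * s by nra.
case: b e => /= e; split; try (by apply/eqP; lra);
  by apply: (mulfI (lt0r_neq0 w0)); lra.
Qed.

Lemma inside_meet c t c' t' s s' :
  borders t (Some (letter_colour c)) -> borders t' (Some (letter_colour c')) ->
  0 <= s <= 1 -> 0 <= s' <= 1 -> outer c t = outer c' t' -> (c, t) <> (c', t') ->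
  same_place (outer c t) (inside c t s) (inside c' t' s') ->
  [/\ s = 1, s' = 0 & next c t c' t'] \/ [/\ s = 0, s' = 1 & next c' t' c t].
Proof.
move=> bt bt' s01 s'01 oE ne [e|[oW [[e e']|[e e']]]].
- have [/andP[h /implyP nx]|/andP[h /implyP nx]] := eighths_meet bt bt' oE ne.
    have [-> -> /eqP/nx ?] := inside_consecutive h s01 s'01 e.
    by left.
  have [-> -> /eqP/nx ?] := inside_consecutive h s'01 s01 (esym e).
  by right.
- have [-> /eqP h] := inside_end_eighths (b := false) bt s01 e.
  have [-> /eqP h'] := inside_end_eighths (b := true) bt' s'01 e'.
  by right; split=> //; apply: eighths_wrap h h'; rewrite -?oE.
- have [-> /eqP h] := inside_end_eighths (b := true) bt s01 e.
  have [-> /eqP h'] := inside_end_eighths (b := false) bt' s'01 e'.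
  by left; split=> //; apply: eighths_wrap h' h; rewrite -?oE.
Qed.

(** Over the replacement graphs only six arcs reach an end of the arc that
    contains them, and they do so with the same vertex and the same bit. *)
Lemma inside_end c t s (b : bool) : borders t (Some (letter_colour c)) ->
  0 <= s <= 1 -> inside c t s = b%:R -> grows_on c <> None ->
  [/\ s = b%:R, leaves_rim t b = leaves_rim (outer c t) b &
      forall p, corner (rcons p c) t b = corner p (outer c t) b].
Proof.
move=> bt s01 e gc; have [-> h] := inside_end_eighths bt s01 e.
split=> // [|p]; last rewrite /corner edge_at_rcons;
  by move: bt h gc; case: c {e} => //; case: t => //; case: b.
Qed.

(** Following an end of an arc inwards never changes the vertex over it. *)
Lemma place_end o t w s (b : bool) : o <> None -> wf o w -> borders t (last_colour o w) ->
  0 <= s <= 1 -> place t w s = b%:R ->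
  [/\ s = b%:R, leaves_rim t b = leaves_rim (first_arc t w) b &
      forall p, corner (p ++ w) t b = corner p (first_arc t w) b].
Proof.
elim: w o => [|c w IH] o o0 /=; first by split=> // p; rewrite cats0.
move=> /andP[/eqP gc cw] tw s01 pE.
have bt := borders_first cw tw.
have [|sE k h] := inside_end bt (place_bounds cw tw s01) pE; first by rewrite gc.
have [//|sE' k' h'] := IH (Some (letter_colour c)) _ cw tw s01 sE.
split=> //; first by rewrite k'.
by move=> p; rewrite -cat_rcons h' h.
Qed.

(** What the words have to satisfy for neither arc to contain the other; the two
    arcs over one blue edge are allowed. *)
Definition separated (w : word) (t : arc) (w' : word) (t' : arc) : Prop :=
  [/\ prefix w w' -> w = w', prefix w' w -> w = w' & w = w' -> t <> t'].

Lemma separated_cons c w t w' t' :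
  separated (c :: w) t (c :: w') t' -> separated w t w' t'.
Proof.
case=> h1 h2 h3; split.
- by move=> h; suff [] : c :: w = c :: w' by []; apply: h1; rewrite /= eqxx.
- by move=> h; suff [] : c :: w = c :: w' by []; apply: h2; rewrite /= eqxx.
- by move=> e; apply: h3; rewrite e.
Qed.

(** Inside the smallest arc that contains both arcs, they belong to consecutive
    pieces, so they meet where one piece ends and the next begins; there the
    vertices agree by [next_corner]. *)
Lemma meet_corner p w t w' t' s s' :
  wf (last_colour None p) w -> wf (last_colour None p) w' ->
  borders t (last_colour None (p ++ w)) -> borders t' (last_colour None (p ++ w')) ->
  0 <= s <= 1 -> 0 <= s' <= 1 -> separated w t w' t' ->
  first_arc t w = first_arc t' w' ->
  same_place (first_arc t w) (place t w s) (place t' w' s') ->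
  exists b b' : bool, [/\ s = b%:R, s' = b'%:R,
    corner (p ++ w) t b = corner (p ++ w') t' b' &
    leaves_rim t b = leaves_rim t' b' \/ tip (corner (p ++ w) t b)].
Proof.
elim: w w' p => [|c w IH] [|c' w'] p.
- by move=> _ _ _ _ _ _ [_ _ /(_ erefl) ne] /= /ne.
- by move=> _ _ _ _ _ _ [/(_ (prefix0s _))].
- by move=> _ _ _ _ _ _ [_ /(_ (prefix0s _))].
rewrite !last_colour_cat => cw cw' tw tw' s01 s'01 sep /= fE pE.
move: cw cw' tw tw' => /= /andP[gc cw] /andP[gc' cw'] tw tw'.
have bt := borders_first cw tw; have bt' := borders_first cw' tw'.
have ps := place_bounds cw tw s01; have ps' := place_bounds cw' tw' s'01.
have lc d u : grows_on d == last_colour None p ->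
    last_colour (Some (letter_colour d)) u = last_colour None (rcons p d ++ u).
  by move=> _; rewrite last_colour_cat last_colour_rcons.
have [[e1 e2]|ne] := eqVneq (c, first_arc t w) (c', first_arc t' w').
  subst c'; rewrite -!cat_rcons; apply: IH => //.
  - by rewrite last_colour_rcons.
  - by rewrite last_colour_rcons.
  - by rewrite -lc.
  - by rewrite -lc.
  - exact: separated_cons sep.
  - have pE' : same_place (outer c (first_arc t w))
        (place (first_arc t w) [:: c] (place t w s))
        (place (first_arc t w) [:: c] (place t' w' s')).
      by move: pE; rewrite /= -e2.
    by left; apply: same_place_inj pE'.
have [||] := inside_meet bt bt' ps ps' fE _ pE; first by move/eqP: ne.
  move=> [a1 a2 nx]; exists true, false.
  have [//|sE k h] := @place_end _ t w s true _ cw tw s01 a1.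
  have [//|sE' k' h'] := @place_end _ t' w' s' false _ cw' tw' s'01 a2.
  have [n1 n2] := next_corner p nx bt bt'.
  by split=> //; rewrite -!cat_rcons h ?h' // k k'.
move=> [a1 a2 nx]; exists false, true.
have [//|sE k h] := @place_end _ t w s false _ cw tw s01 a1.
have [//|sE' k' h'] := @place_end _ t' w' s' true _ cw' tw' s'01 a2.
have [n1 n2] := next_corner p nx bt' bt.
split=> //; rewrite -!cat_rcons h ?h' // k k'.
by rewrite -n1; case: n2 => [->|]; [left|right].
Qed.

(** ** Points of the circle *)

Lemma clamp_unit (x : R) : unit_interval R (Num.max 0 (Num.min 1 x)).
Proof.
rewrite /unit_interval /= in_itv /=; apply/andP; split.
  by rewrite le_max lexx.
by rewrite ge_max ler01 ge_min lexx.
Qed.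

Definition clamp (x : R) : unit_interval R := SigSub (mem_set (clamp_unit x)).

Definition spot (x : R) : circle R := circle_class (clamp x).

Lemma clamp_id (x : R) : 0 <= x <= 1 -> val (clamp x) = x.
Proof. by move=> /andP[x0 x1] /=; rewrite min_r // max_r. Qed.

Lemma unit_bounds (x : unit_interval R) : 0 <= val x <= 1.
Proof. by have := set_mem (valP x); rewrite /unit_interval /= in_itv. Qed.

Lemma circle_class_spot (x : unit_interval R) : circle_class x = spot (val x).
Proof.
by congr circle_class; apply: val_inj; rewrite clamp_id // unit_bounds.
Qed.

Lemma spot_surj (c : circle R) : exists2 x, 0 <= x <= 1 & c = spot x.
Proof.
exists (val (repr (c : {eq_quot (identified_equiv R)}))).
  exact: unit_bounds.
by rewrite -circle_class_spot /circle_class reprK.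
Qed.

Lemma spot_eq (x y : R) : 0 <= x <= 1 -> 0 <= y <= 1 ->
  spot x = spot y <-> same_place Whole x y.
Proof.
move=> x01 y01; have ex := clamp_id x01; have ey := clamp_id y01.
have [x0 x1] := andP x01; have [y0 y1] := andP y01.
have -> : (spot x = spot y) <-> identified (clamp x) (clamp y).
  by split=> [/eqmodP|h] //; apply/eqmodP.
rewrite /identified /endpoint -val_eqE ex ey.
split=> [/orP[/eqP|/andP[/orP[]/eqP e /orP[]/eqP e']]|]; rewrite /same_place.
- by left.
- by left; rewrite e e'.
- by right; split=> //; left.
- by right; split=> //; right.
- by left; rewrite e e'.
- by case=> [->|[_ [[-> ->]|[-> ->]]]]; rewrite ?eqxx ?orbT.
Qed.

(** The point of the circle for a vertex and a bit, read off from the division of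
    the arcs over the edge whose replacement creates the vertex. *)
Definition corner_spot (k : bool) (v : vertex) : circle R :=
  let: (w, l) := v in
  match l, k with
  | va, true => spot 0 | va, false => spot (eighth 2)
  | vb, true => spot (eighth 4) | vb, false => spot (eighth 6)
  | vl, _ => spot (eighth 1) | vr, _ => spot (eighth 5)
  | vm, true => spot (place Rim w (eighth 2))
  | vm, false => spot (place Rim w (eighth 6))
  | vw, _ => spot (place Rim w (eighth 4))
  | vx, true => spot (place Back w (eighth 4))
  | vx, false => spot (place Out w (eighth 2))
  | vy, true => spot (place Out w (eighth 4))
  | vy, false => spot (place Back w (eighth 2))
  end.

Lemma tip_corner_spot v k k' : tip v -> corner_spot k v = corner_spot k' v.
Proof. by case: v => w []. Qed.

Lemma spot01 : spot 1 = spot 0.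
Proof. by apply/spot_eq; rewrite ?lexx ?ler01 //; right; split=> //; right. Qed.

Lemma eighth0 : eighth 0 = 0.
Proof. by rewrite /eighth mul0r. Qed.

Lemma eighth8 : eighth 8 = 1.
Proof. by rewrite /eighth divff // pnatr_eq0. Qed.

Lemma inside_bool c t (b : bool) :
  inside c t b%:R = eighth (offset8 c t + width8 c t * b).
Proof. by rewrite /inside /eighth natrD natrM mulrDl; ring. Qed.

(** An arc created by a replacement either begins or ends inside its parent, at a
    new vertex for which [corner_spot] is this very position, or it shares an end
    with its parent. *)
Lemma spot_corner w t (b : bool) : valid w -> w != [::] -> borders t (last_colour None w) ->
  spot (place t w b%:R) = corner_spot (leaves_rim t b) (corner w t b).
Proof.
elim/last_ind: w t b => // w c IH t b vw _.
rewrite last_colour_rcons place_rcons inside_bool => tc.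
have [w0|w0] := eqVneq w [::].
  move: vw tc; rewrite w0 /corner /edge_at /=.
  by case: c => // _; case: t => // _; case: b; rewrite //= ?eighth0 // eighth8 spot01.
have gc : grows_on c = last_colour None w.
  by move: vw; rewrite wf_rcons => /andP[_ /eqP].
have tb := borders_outer tc gc.
have old (b' : bool) : eighth (offset8 c t + width8 c t * b) = b'%:R ->
    leaves_rim t b = leaves_rim (outer c t) b' ->
    corner (rcons w c) t b = corner w (outer c t) b' ->
  spot (place (outer c t) w (eighth (offset8 c t + width8 c t * b))) =
  corner_spot (leaves_rim t b) (corner (rcons w c) t b).
  by move=> -> -> ->; apply: IH => //; exact: valid_rcons_inv vw.
have gn : grows_on c <> None by rewrite gc (colour_edge_at w0).
move: tc gn old; rewrite /corner edge_at_rcons.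
by case: c {vw gc tb} => //; case: t => //= _ _; case: b => old;
  rewrite ?name_edge_at //;
  first [ by apply: (old true) => //; exact: eighth8
        | by apply: (old false) => //; exact: eighth0 ].
Qed.

(** * Lifting a rearrangement to the circle *)

Lemma canonical_end_word f w w' b : canonical_on f w w' ->
  f (point (end_word w b)) = point (end_word w' b).
Proof.
case=> -[vw w0 vw' w'0 c] h; rewrite /end_word -c; apply: h.
exact: end_word_admissible.
Qed.

(** A common vertex is an equality of points of the limit space, which a
    rearrangement preserves. *)
Lemma canonical_same_end (f : homeo airplane) w1 w1' w2 w2' b1 b2 :
  canonical_on f w1 w1' -> canonical_on f w2 w2' ->
  edge_end (edge_at w1) b1 = edge_end (edge_at w2) b2 ->
  edge_end (edge_at w1') b1 = edge_end (edge_at w2') b2.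
Proof.
move=> f1 f2; have [[v1 n1 v1' n1' _] _] := f1; have [[v2 n2 v2' n2' _] _] := f2.
move/(touch_end_word b1 b2 v1 n1 v2 n2).
move/(point_eq (end_word_admissible b1 v1 n1) (end_word_admissible b2 v2 n2)).
move/(congr1 f); rewrite (canonical_end_word b1 f1) (canonical_end_word b2 f2).
move/(point_eq (end_word_admissible b1 v1' n1') (end_word_admissible b2 v2' n2')).
by move/(touch_end_word b1 b2 v1' n1' v2' n2').
Qed.

(** If the image of a tip were not a tip, it would also be represented by a word
    that ends along red edges. Pulled back by the inverse, this word would
    represent the tip, so it would come from the unique word of the tip, which
    ends along blue edges. *)
Lemma canonical_tip (f : homeo airplane) n w w' b : canonical_at f n ->
  canonical_on f w w' -> tip (edge_end (edge_at w) b) ->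
  tip (edge_end (edge_at w') b).
Proof.
move=> fn fw tw; have [[vw w0 vw' w'0 cw] _] := fw; apply: contrapT => /negP ntw.
have [w3 [b3 [v3 n3 c3 e3]]] := red_end vw' w'0 ntw.
have [_ cB] := tip_end vw w0 tw.
(* It suffices to identify a red and a blue end word. *)
suff /end_word_colour : end_word w3 b3 = end_word w' b by rewrite c3 -cw cB.
have [m fm] := canonical_at_inv fn.
have a3 := end_word_admissible b3 v3 n3.
pose g := prefix_word (end_word w3 b3) m.+1.
have [|g0 fg0] := fm g (a3 _); first by rewrite size_prefix.
have fg : canonical_on f g0 g by apply: canonical_inv fg0; exact: homeo_invK.
pose x k := end_word w3 b3 (m.+1 + k).
have gx : cat_word g x = end_word w3 b3 by exact: cat_word_shift.
have ag0 : admissible (cat_word g0 x).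
  by have [tg _] := fg0; apply: twin_admissible tg _; rewrite gx.
(* The inverse turns [end_word w3 b3] into a word glued to that of the tip. *)
have xE : cat_word g0 x = end_word w b.
  apply: (tip_touch vw w0 tw ag0); apply/point_eq; rewrite //; first exact: end_word_admissible.
  apply: (can_inj (homeoK f)); rewrite (canonical_end_word b fw) fg.2 // gx.
  apply/point_eq => //; first exact: end_word_admissible.
  exact/touch_end_word.
rewrite -gx; have [sz|/ltnW sz] := leqP (size g0) (size w).
  have [u wE uE] := prefixes_comparable xE sz.
  rewrite uE -cat_word_cat /end_word -cw; congr cat_word; apply/esym.
  by apply: canonical_unique_cat fg _; rewrite -wE.
have [u g0E uE] := prefixes_comparable (esym xE) sz.
have -> : g = w' ++ u by apply: canonical_unique_cat fw _; rewrite -g0E.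
by rewrite cat_word_cat -uE /end_word cw.
Qed.

Lemma lift_separated (f : homeo airplane) n w1 w1' w2 w2' t1 t2 s1 s2 :
  canonical_at f n -> canonical_on f w1 w1' -> canonical_on f w2 w2' ->
  borders t1 (last_colour None w1) -> borders t2 (last_colour None w2) ->
  0 <= s1 <= 1 -> 0 <= s2 <= 1 -> separated w1 t1 w2 t2 ->
  spot (place t1 w1 s1) = spot (place t2 w2 s2) ->
  spot (place t1 w1' s1) = spot (place t2 w2' s2).
Proof.
move=> fn f1 f2 bt1 bt2 s01 s02 sep.
have [[v1 n1 v1' n1' c1] _] := f1; have [[v2 n2 v2' n2' c2] _] := f2.
have p1 := place_bounds v1 bt1 s01; have p2 := place_bounds v2 bt2 s02.
have fa1 : first_arc t1 w1 = Whole := borders_whole (borders_first v1 bt1).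
have fa2 : first_arc t2 w2 = Whole := borders_whole (borders_first v2 bt2).
move/(spot_eq p1 p2) => pE.
have [||b1 [b2 [-> -> vE kE]]] := @meet_corner [::] w1 t1 w2 t2 s1 s2 v1 v2 bt1 bt2 s01 s02 sep.
  by rewrite fa1 fa2.
  by rewrite fa1.
rewrite /= in vE kE.
have vE' : corner w1' t1 b1 = corner w2' t2 b2 := canonical_same_end f1 f2 vE.
rewrite !spot_corner -?(twin_last_colour f1.1) -?(twin_last_colour f2.1) // -vE'.
case: kE => [->//|tp]; apply: tip_corner_spot.
exact: canonical_tip fn f1 tp.
Qed.

(** If one word is a prefix of the other, uniqueness of canonical images reduces
    to two arcs over the same word, which either coincide or are separated. *)
Lemma lift_unique (f : homeo airplane) n w1 w1' w2 w2' t1 t2 s1 s2 :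
  canonical_at f n -> canonical_on f w1 w1' -> canonical_on f w2 w2' ->
  borders t1 (last_colour None w1) -> borders t2 (last_colour None w2) ->
  0 <= s1 <= 1 -> 0 <= s2 <= 1 ->
  spot (place t1 w1 s1) = spot (place t2 w2 s2) ->
  spot (place t1 w1' s1) = spot (place t2 w2' s2).
Proof.
move=> fn; move: w1 w1' w2 w2' t1 t2 s1 s2.
have pre w1 w1' w2 w2' t1 t2 s1 s2 : prefix w1 w2 ->
    canonical_on f w1 w1' -> canonical_on f w2 w2' ->
    borders t1 (last_colour None w1) -> borders t2 (last_colour None w2) ->
    0 <= s1 <= 1 -> 0 <= s2 <= 1 ->
    spot (place t1 w1 s1) = spot (place t2 w2 s2) ->
    spot (place t1 w1' s1) = spot (place t2 w2' s2).
  move=> /prefixP[u ->] f1 f2 bt1 + s01 s02.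
  have [[v1 n1 v1' n1' c1] _] := f1; have [[vu _ _ _ _] _] := f2.
  have cu : wf (last_colour None w1) u by move: vu; rewrite wf_cat => /andP[].
  rewrite last_colour_cat (canonical_unique_cat f1 f2) !place_cat => bt2.
  have bt := borders_first cu bt2; have s02' := place_bounds cu bt2 s02.
  move: (first_arc t2 u) (place t2 u s2) bt s02' => t s bt s0.
  have [<- e|ne] := eqVneq t1 t; last first.
    apply: (lift_separated fn f1 f1) => //; split=> // _.
    exact/eqP.
  suff -> : s1 = s by [].
  apply: (same_place_inj (t := t1) (u := Whole) n1 s01 s0).
  exact/(spot_eq (place_bounds v1 bt1 s01) (place_bounds v1 bt1 s0)).
move=> w1 w1' w2 w2' t1 t2 s1 s2 f1 f2 bt1 bt2 s01 s02 e.
have [p12|p12] := boolP (prefix w1 w2); first exact: pre p12 f1 f2 bt1 bt2 s01 s02 e.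
have [p21|p21] := boolP (prefix w2 w1).
  exact/esym/(pre _ _ _ _ _ _ _ _ p21 f2 f1 bt2 bt1 s02 s01 (esym e)).
apply: (lift_separated fn f1 f2) => //.
split; [by rewrite (negbTE p12)|by rewrite (negbTE p21)|].
by move=> e12; move: p12; rewrite e12 prefix_refl.
Qed.

Lemma place_cover k o t x : borders t o -> 0 <= x <= 1 ->
  exists w t' s, [/\ size w = k /\ wf o w, borders t' (last_colour o w),
    first_arc t' w = t, 0 <= s <= 1 & x = place t' w s].
Proof.
elim: k o t x => [|k IH] o t x bt x01; first by exists [::], t, x.
suff [c [t1 [y [gc bt1 oE y01 ->]]]] : exists c t1 y,
    [/\ grows_on c = o, borders t1 (Some (letter_colour c)), outer c t1 = t,
        0 <= y <= 1 & x = inside c t1 y].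
  have [w [t2 [s [[sw cw] bt2 fE s01 ->]]]] := IH _ _ _ bt1 y01.
  by exists (c :: w), t2, s; rewrite /= sw gc eqxx fE.
have kid c t1 : [&& grows_on c == o, borders t1 (Some (letter_colour c)) &
      outer c t1 == t] ->
    eighth (offset8 c t1) <= x <= eighth (offset8 c t1 + width8 c t1) ->
    exists c t1 y, [/\ grows_on c = o, borders t1 (Some (letter_colour c)),
      outer c t1 = t, 0 <= y <= 1 & x = inside c t1 y].
  move=> /and3P[/eqP gc bt1 /eqP oE] /andP[x1 x2].
  exists c, t1, ((x - eighth (offset8 c t1)) / eighth (width8 c t1)).
  have /andP[w0 _] := eighth_width c t1.
  split=> //; last by rewrite /inside mulrC divfK ?gt_eqF // addrC subrK.
  rewrite divr_ge0 ?subr_ge0 ?(ltW w0) //= ler_pdivrMr // mul1r lerBlDl.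
  by move: x2; rewrite /eighth natrD mulrDl.
have [x0 x8] : eighth 0 <= x /\ x <= eighth 8.
  by rewrite eighth0 eighth8; apply/andP.
have cut i j (P : Prop) : (eighth i <= x <= eighth j -> P) ->
    (eighth j <= x -> P) -> eighth i <= x -> P.
  move=> h1 h2 xi; have [xj|/ltW/h2//] := leP x (eighth j).
  by apply: h1; rewrite xi.
case: o t bt kid => [[]|] [] // _ kid.
- apply: (cut 0%N 2%N) x0; first exact: (kid r1 Rim).
  apply: (cut 2%N 4%N); first exact: (kid bs Out).
  apply: (cut 4%N 6%N); first exact: (kid bs Back).
  by move=> h; apply: (kid r2 Rim) => //; rewrite h.
- apply: (cut 0%N 2%N) x0; first exact: (kid bm Back).
  apply: (cut 2%N 4%N); first exact: (kid ed Rim).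
  by move=> h; apply: (kid bp Out) => //; rewrite h.
- apply: (cut 0%N 2%N) x0; first exact: (kid bp Back).
  apply: (cut 2%N 4%N); first exact: (kid eu Rim).
  by move=> h; apply: (kid bm Out) => //; rewrite h.
- apply: (cut 0%N 1%N) x0; first exact: (kid eL Out).
  apply: (cut 1%N 2%N); first exact: (kid eL Back).
  apply: (cut 2%N 4%N); first exact: (kid eD Rim).
  apply: (cut 4%N 5%N); first exact: (kid eR Out).
  apply: (cut 5%N 6%N); first exact: (kid eR Back).
  by move=> h; apply: (kid eU Rim) => //; rewrite h.
Qed.

Lemma circle_cover k (c : circle R) : exists w t s,
  [/\ size w = k /\ valid w, borders t (last_colour None w), 0 <= s <= 1 &
      c = spot (place t w s)].
Proof.
have [x x01 ->] := spot_surj c.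
have [w [t [s [h bt _ s01 ->]]]] := place_cover k (isT : borders Whole None) x01.
by exists w, t, s.
Qed.

(** The graph of the lift. *)
Definition carries (f : airplane -> airplane) (c c' : circle R) : Prop :=
  exists w w' t s, [/\ canonical_on f w w', borders t (last_colour None w),
    0 <= s <= 1, c = spot (place t w s) & c' = spot (place t w' s)].

Lemma lift_exists (f : airplane -> airplane) : exists g : circle R -> circle R,
  forall n, canonical_at f n -> forall c, carries f c (g c).
Proof.
have /boolp.choice[g gP] c : exists c', forall n, canonical_at f n -> carries f c c'.
  have [[n fn]|nf] := pselect (exists n, canonical_at f n); last first.
    by exists c => n fn; case: nf; exists n.
  have [w [t [s [[sw vw] bt s01 cE]]]] := circle_cover n.+1 c.
  have [|w' fw] := fn w vw; first by rewrite sw.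
  by exists (spot (place t w' s)) => m _; exists w, w', t, s.
by exists g => n fn c; exact: gP fn.
Qed.

Definition lift (f : airplane -> airplane) : circle R -> circle R :=
  sval (cid (lift_exists f)).

Lemma lift_place (f : homeo airplane) n w w' t s : canonical_at f n ->
  canonical_on f w w' -> borders t (last_colour None w) -> 0 <= s <= 1 ->
  lift f (spot (place t w s)) = spot (place t w' s).
Proof.
move=> fn fw bt s01.
have := svalP (cid (lift_exists f)) n fn (spot (place t w s)).
rewrite -/(lift f) => -[w1 [w1' [t1 [s1 [f1 bt1 s11 e ->]]]]].
exact/esym/(lift_unique fn fw f1).
Qed.

Lemma lift_inv (f : homeo airplane) n : canonical_at f n ->
  cancel (lift f) (lift (homeo_inv f)).
Proof.
move=> fn c; have [m fm] := canonical_at_inv fn.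
have [w [t [s [[sw vw] bt s01 ->]]]] := circle_cover n.+1 c.
have [|w' fw] := fn w vw; first by rewrite sw.
have fw' : canonical_on (homeo_invg f) w' w.
  by apply: canonical_inv fw; exact: homeoK.
rewrite (lift_place fn fw) // (@lift_place (homeo_invg f) m w' w) //.
by rewrite -(twin_last_colour fw.1).
Qed.

Lemma spot_continuous : continuous (spot : R -> circle R).
Proof.
have cc : continuous (clamp : R -> unit_interval R).
  have cm : continuous (fun x : R => Num.max 0 (Num.min 1 x)).
    move=> x; apply: continuous_max; first exact: cst_continuous.
    apply: continuous_min; first exact: cst_continuous.
    exact: cvg_id.
  apply/continuousP => A oA.
  have [V oV <-] : exists2 V : set R, open V & val @^-1` V = A by exact: oA.
  by move/continuousP: cm => /(_ _ oV).
move=> x; apply: continuous_comp; first exact: cc.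
exact: pi_continuous.
Qed.

(** The preimage of a closed set is a union of closed pieces, one over each of the
    finitely many arcs of some level. *)
Lemma lift_continuous (f : homeo airplane) n : canonical_at f n ->
  continuous (lift f).
Proof.
move=> fn; have [F [_ [FP _ _]]] := canonical_image fn.
apply/quotient_continuous/continuous_closedP => K cK.
pose index := [seq (w, t) | w <- level_words n, t <- [:: Rim; Out; Back]].
pose ok (i : word * arc) := borders i.2 (last_colour None i.1).
pose rel (i : word * arc) (x : R) := (x - place i.2 i.1 0) / span i.2 i.1.
pose piece (i : word * arc) : set (unit_interval R) := [set x |
  [/\ 0 <= rel i (val x), rel i (val x) <= 1 &
      K (spot (place i.2 (F i.1) (rel i (val x))))]].
have -> : (lift f \o \pi_{eq_quot (identified_equiv R)}) @^-1` K =
    \bigcup_(i in [set` [seq i <- index | ok i]]) piece i.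
  apply/seteqP; split=> [x /= Kx|x [[w t]]]; last first.
    rewrite /= mem_filter => /andP[bt /allpairsP[[w1 t1] /= [wn _ [? ?]]]].
    subst w1 t1; case=> r0 r1 Kx.
    have xE : val x = place t w (rel (w, t) (val x)).
      by rewrite place_span /rel /= mulrC divfK ?gt_eqF ?span_gt0 // addrC subrK.
    have := circle_class_spot x; rewrite /circle_class => ->.
    by rewrite xE (lift_place fn (FP _ wn)) ?r0.
  have [w [t [s [[sw vw] bt _ s01 xE]]]] :=
    place_cover n.+1 (isT : borders Whole None) (unit_bounds x).
  have wn : w \in level_words n by rewrite mem_level_words vw sw eqxx.
  have w0 : w != [::] by rewrite -size_eq0 sw.
  have sE : rel (w, t) (val x) = s.
    by rewrite /rel /= xE place_span addrAC subrr add0r mulrAC divff ?mul1r // gt_eqF // span_gt0.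
  exists (w, t).
    rewrite /= mem_filter /ok /= bt; apply/allpairsP; exists (w, t); split=> //.
    by move: bt; rewrite colour_edge_at //; case: (edge_colour _); case: (t).
  have := circle_class_spot x; rewrite /circle_class => cE; move: Kx.
  rewrite cE xE (lift_place fn (FP _ wn)) // => Kx.
  by split; rewrite -?xE sE //; case/andP: s01.
apply: closed_bigcup; first exact: finite_seq.
move=> i _.
have crel : continuous (rel i : R -> R).
  move=> x; apply: cvgMl; apply: cvgB; first exact: cvg_id.
  exact: cvg_cst.
have cval : continuous (rel i \o val : unit_interval R -> R).
  move=> x; apply: continuous_comp; last exact: crel.
  exact: initial_continuous.
have cplace : continuous (place i.2 (F i.1) : R -> R).
  have -> : place i.2 (F i.1) = fun s => place i.2 (F i.1) 0 + span i.2 (F i.1) * s.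
    by apply: boolp.funext => s; exact: place_span.
  move=> x; apply: cvgD; first exact: cvg_cst.
  by apply: cvgMr; exact: cvg_id.
have -> : piece i = ((rel i \o val) @^-1` [set x | 0 <= x]) `&`
    (((rel i \o val) @^-1` [set x | x <= 1]) `&`
     ((spot \o place i.2 (F i.1) \o (rel i \o val)) @^-1` K)).
  by apply/seteqP; split=> [x [? ? ?]|x [? [? ?]]].
apply: closedI; last apply: closedI.
- by apply: preimage_closed => [x _|]; [exact: cval|exact: closed_ge].
- by apply: preimage_closed => [x _|]; [exact: cval|exact: closed_le].
- apply: preimage_closed => // x _; apply: continuous_comp; first exact: cval.
  apply: continuous_comp; first exact: cplace.
  exact: spot_continuous.
Qed.

Lemma lift_homeo (f : homeo airplane) n : canonical_at f n ->
  exists g : homeo (circle R), homeo_fun g = lift f.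
Proof.
move=> fn; have [m fm] := canonical_at_inv fn.
have fm' : canonical_at (homeo_invg f) m by [].
by exists (Homeo (lift_continuous fn) (lift_continuous fm') (lift_inv fn)
  (lift_inv fm')).
Qed.

Lemma circle_action_exists : exists phi : homeo airplane -> homeo (circle R),
  forall f, T_A f -> homeo_fun (phi f) = lift f.
Proof.
have /boolp.choice[phi phiP] (f : homeo airplane) : exists g : homeo (circle R),
    T_A f -> homeo_fun g = lift f.
  have [/T_A_canonical_at[n fn]|nf] := pselect (T_A f); last by exists 1%g.
  by have [g gE] := lift_homeo fn; exists g.
by exists phi.
Qed.

Definition circle_action : homeo airplane -> homeo (circle R) :=
  sval (cid circle_action_exists).

Lemma circle_actionE f : T_A f -> homeo_fun (circle_action f) = lift f.
Proof. exact: svalP (cid circle_action_exists) f. Qed.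

Lemma circle_action_place (f : homeo airplane) w w' t s : T_A f ->
  canonical_on f w w' -> borders t (last_colour None w) -> 0 <= s <= 1 ->
  circle_action f (spot (place t w s)) = spot (place t w' s).
Proof.
move=> Tf fw bt s01; rewrite (circle_actionE Tf).
by have [n fn] := rearrangement_canonical_at Tf; exact: lift_place fn fw bt s01.
Qed.

Lemma circle_actionM (f g : homeo airplane) : T_A f -> T_A g ->
  circle_action (f * g)%g = (circle_action f * circle_action g)%g.
Proof.
move=> Tf Tg; apply: homeo_ext; apply: boolp.funext => c.
have [n fn] := rearrangement_canonical_at Tf.
have [m gm] := rearrangement_canonical_at Tg.
have Tfg : T_A (f * g)%g.
  by apply/T_A_canonical_at; exists (m + n)%N; exact: canonical_at_comp.
have [w [t [s [[sw vw] bt s01 ->]]]] := circle_cover (m + n).+1 c.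
have [|w' [w'' [gw fw]]] := canonical_pair fn gm vw; first by rewrite sw.
rewrite (circle_action_place Tfg (canonical_comp gw fw)) //=.
rewrite (circle_action_place Tg gw) // (circle_action_place Tf fw) //.
by rewrite -(twin_last_colour gw.1).
Qed.

(** Separated arcs share at most their ends, and an arc contained in another one
    with the same coordinates has the same length. *)
Lemma arc_inj w w' t : valid w -> w != [::] -> valid w' -> w' != [::] ->
  borders t (last_colour None w) -> borders t (last_colour None w') ->
  (forall s, 0 <= s <= 1 -> spot (place t w s) = spot (place t w' s)) -> w = w'.
Proof.
wlog : w w' / prefix w' w -> prefix w w'.
  move=> W v n v' n' b b' h.
  have [p|np] := boolP (prefix w w'); first exact: W.
  by apply/esym/W => // [|s s01]; [rewrite (negbTE np)|exact/esym/h].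
move=> W vw w0 vw' w'0 bt bt' h.
have half : 0 <= (1 / 2%:R : R) <= 1 by apply/andP; split; lra.
have nsep a ta b tb : valid a -> valid b -> borders ta (last_colour None a) ->
    borders tb (last_colour None b) -> separated a ta b tb ->
    forall y, 0 <= y <= 1 -> spot (place ta a (1 / 2%:R)) = spot (place tb b y) ->
    False.
  move=> va vb ba bb sep y y01 e.
  have pa := place_bounds va ba half; have pb := place_bounds vb bb y01.
  have fa := borders_whole (borders_first va ba).
  have fb := borders_whole (borders_first vb bb).
  have [||b1 [b2 [e1 _ _ _]]] :=
      @meet_corner [::] a ta b tb _ _ va vb ba bb half y01 sep.
  - by rewrite fa fb.
  - by rewrite fa; apply/(spot_eq pa pb).
  - by case: b1 e1 => /= e1; lra.
have [p|np] := boolP (prefix w w'); last first.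
  case: (nsep w t w' t vw vw' bt bt' _ _ half (h _ half)).
  split=> [p|p|e]; [by rewrite p in np|by case/negP: np; apply: W|].
  by move: np; rewrite e prefix_refl.
move: p => /prefixP[u w'E]; rewrite w'E in vw' bt' h *.
have cu : wf (last_colour None w) u by move: vw'; rewrite wf_cat => /andP[].
rewrite last_colour_cat in bt'; have bu := borders_first cu bt'.
have [u0|u0] := eqVneq u [::]; first by rewrite u0 cats0.
have [tE|tE] := eqVneq (first_arc t u) t; last first.
  case: (nsep w t w (first_arc t u) vw vw bt bu _ (place t u (1 / 2%:R))).
  - by split=> // _; apply/eqP; rewrite eq_sym.
  - exact: place_bounds cu bt' half.
  - by rewrite h // place_cat.
have eu s : 0 <= s <= 1 -> s = place t u s.
  move=> s01; have us := place_bounds cu bt' s01.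
  apply: (same_place_inj (t := t) (u := Whole) w0 s01 us).
  apply/(spot_eq (place_bounds vw bt s01) (place_bounds vw bt us)).
  by rewrite h // place_cat tE.
have := span_lt1 t u0.
by rewrite /span -!eu ?lexx ?ler01 // subr0 ltxx.
Qed.

Lemma circle_action_inj : {in T_A &, injective circle_action}.
Proof.
move=> f g /set_mem Tf /set_mem Tg e.
have [n fn] := rearrangement_canonical_at Tf.
have [m gm] := rearrangement_canonical_at Tg.
apply: homeo_ext; apply: boolp.funext => a; have [z az ->] := point_surj a.
pose w := prefix_word z (n + m).+1; pose x k := z ((n + m).+1 + k)%N.
have zE : z = cat_word w x by rewrite cat_word_shift.
have [|a1 f1] := fn w (az _); first by rewrite size_prefix; lia.
have [|a2 g2] := gm w (az _); first by rewrite size_prefix; lia.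
have az' : admissible (cat_word w x) by rewrite -zE.
rewrite zE f1.2 // g2.2 //; congr (point (cat_word _ x)).
have [[vw w0 va1 a10 c1] _] := f1; have [[_ _ va2 a20 c2] _] := g2.
have [t bt] : exists t, borders t (last_colour None w).
  by rewrite colour_edge_at //; case: (edge_colour _); [exists Rim|exists Out].
apply: (arc_inj (t := t)) => //.
- by rewrite -(twin_last_colour f1.1).
- by rewrite -(twin_last_colour g2.1).
- move=> s s01; rewrite -(circle_action_place Tf f1) //.
  by rewrite e (circle_action_place Tg g2).
Qed.

(** * The dyadic subdivisions of a rearrangement *)

Definition arc_interval (t : arc) (w : word) : R * R := (place t w 0, place t w 1).

Definition refines (L L' : seq (R * R)) : Prop := forall D1 D2,
  dyadic_subdivision (D1 ++ L ++ D2) -> dyadic_subdivision (D1 ++ L' ++ D2).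

Lemma refines_cat L1 L2 L1' L2' :
  refines L1 L1' -> refines L2 L2' -> refines (L1 ++ L2) (L1' ++ L2').
Proof.
move=> h1 h2 D1 D2; rewrite -!catA => /h1; rewrite !catA -(catA (D1 ++ L1')).
by move/h2; rewrite -!catA.
Qed.

Definition eighths (t : arc) (w : word) (i j : nat) : R * R :=
  (place t w (eighth i), place t w (eighth j)).

(** Halving an interval of a dyadic subdivision and subdividing the halves; in
    terms of eighths, the midpoint of i and j is k. *)
Lemma refines_split t w i j k L L' : (k + k = i + j)%N ->
  refines [:: eighths t w i k] L -> refines [:: eighths t w k j] L' ->
  refines [:: eighths t w i j] (L ++ L').
Proof.
move=> kE h h' D1 D2 d; rewrite -catA.
apply: (h D1 (L' ++ D2)); rewrite catA; apply: h'; rewrite -catA.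
have kr : (k%:R + k%:R = i%:R + j%:R :> R) by rewrite -!natrD kE.
have -> : [:: eighths t w i k] ++ [:: eighths t w k j] ++ D2 =
    (place t w (eighth i), (place t w (eighth i) + place t w (eighth j)) / 2%:R)
    :: ((place t w (eighth i) + place t w (eighth j)) / 2%:R, place t w (eighth j))
    :: D2.
  suff -> : (place t w (eighth i) + place t w (eighth j)) / 2%:R =
    place t w (eighth k) by [].
  rewrite !(place_span t w (eighth _)) /eighth.
  have -> : k%:R = (i%:R + j%:R) / 2%:R :> R by lra.
  by field.
exact: dyadic_halve.
Qed.

Definition kids (t : arc) : seq (letter * arc) :=
  match t with
  | Whole => [:: (eL, Out); (eL, Back); (eD, Rim); (eR, Out); (eR, Back); (eU, Rim)]
  | Rim => [:: (r1, Rim); (bs, Out); (bs, Back); (r2, Rim)]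
  | Out => [:: (bm, Back); (ed, Rim); (bp, Out)]
  | Back => [:: (bp, Back); (eu, Rim); (bm, Out)]
  end.

Lemma kidsP t o c t' : borders t o ->
  ((c, t') \in kids t) =
    [&& grows_on c == o, borders t' (Some (letter_colour c)) & outer c t' == t].
Proof.
move=> bt; apply/idP/idP.
  case: o bt => [[]|]; case: t => //= _; rewrite !inE;
    by do ?[case/orP]; move/eqP => [-> ->]; rewrite /= !eqxx.
case/and3P => /eqP gc bt' /eqP oE; move: bt; rewrite -gc -oE => _.
by move: bt'; case: c {gc oE} => //; case: t' => //= _; rewrite !inE eqxx ?orbT.
Qed.

Lemma arc_interval_rcons t w c :
  arc_interval t (rcons w c) =
    eighths (outer c t) w (offset8 c t) (offset8 c t + width8 c t).
Proof.
rewrite /arc_interval /eighths !place_rcons.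
rewrite -[X in inside _ _ X]/(false%:R) inside_bool muln0 addn0.
by rewrite -[X in inside _ _ X]/(true%:R) inside_bool muln1.
Qed.

Lemma refines_kids t w : refines [:: arc_interval t w]
  [seq arc_interval k.2 (rcons w k.1) | k <- kids t].
Proof.
have -> : arc_interval t w = eighths t w 0 8.
  by rewrite /arc_interval /eighths eighth0 eighth8.
have r i j : refines [:: eighths t w i j] [:: eighths t w i j] by [].
case: t r => r; rewrite /= !arc_interval_rcons /=.
- apply: (@refines_split _ _ 0 8 4 [:: _; _; _] [:: _; _; _]) => //.
    apply: (@refines_split _ _ 0 4 2 [:: _; _] [:: _]) => //.
    exact: (@refines_split _ _ 0 2 1 [:: _] [:: _]).
  apply: (@refines_split _ _ 4 8 6 [:: _; _] [:: _]) => //.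
  exact: (@refines_split _ _ 4 6 5 [:: _] [:: _]).
- apply: (@refines_split _ _ 0 8 4 [:: _; _] [:: _; _]) => //.
    exact: (@refines_split _ _ 0 4 2 [:: _] [:: _]).
  exact: (@refines_split _ _ 4 8 6 [:: _] [:: _]).
- apply: (@refines_split _ _ 0 8 4 [:: _; _] [:: _]) => //.
  exact: (@refines_split _ _ 0 4 2 [:: _] [:: _]).
- apply: (@refines_split _ _ 0 8 4 [:: _; _] [:: _]) => //.
  exact: (@refines_split _ _ 0 4 2 [:: _] [:: _]).
Qed.

(** The arcs over the words of [P], in their order on the circle, found by
    dividing arcs until a word of [P] is reached; [k] bounds the depth. *)
Fixpoint arcs_of (P : seq word) (k : nat) (t : arc) (w : word) : seq (R * R) :=
  if k is k'.+1 then
    if w \in P then [:: arc_interval t w]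
    else flatten [seq arcs_of P k' c.2 (rcons w c.1) | c <- kids t]
  else [:: arc_interval t w].

Lemma refines_arcs_of P k t w : refines [:: arc_interval t w] (arcs_of P k t w).
Proof.
elim: k t w => [|k IH] t w; first by [].
rewrite /=; case: (w \in P); first by [].
move=> D1 D2 d.
have := @refines_kids t w D1 D2 d.
suff : refines [seq arc_interval c.2 (rcons w c.1) | c <- kids t]
    (flatten [seq arcs_of P k c.2 (rcons w c.1) | c <- kids t]) by exact.
elim: (kids t) => [//|c s IHs] /=.
by rewrite -cat1s; exact: refines_cat.
Qed.

Lemma dyadic_arcs_of P k : dyadic_subdivision (arcs_of P k Whole [::]).
Proof. by have := @refines_arcs_of P k Whole [::] [::] [::] (dyadic_unit R); rewrite cats0. Qed.

(** If no proper prefix of [w] is in [P] and [P] meets every extension of [w] by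
    [k] letters, then each branch of the division ends in a word of [P]. *)
Lemma arcs_of_sound P k t w I : valid w -> borders t (last_colour None w) ->
  (forall v, v \in P -> prefix v w -> v = w) ->
  (forall u, valid (w ++ u) -> size u = k ->
     exists2 v, v \in P & prefix v (w ++ u)) ->
  I \in arcs_of P k t w ->
  exists v t', [/\ v \in P, borders t' (last_colour None v) & I = arc_interval t' v].
Proof.
elim: k t w => [|k IH] t w vw bt pre cov /=.
  rewrite inE => /eqP->; have [||v vP] := cov [::]; rewrite ?cats0 //.
  by move=> /(pre _ vP) vE; exists w, t; rewrite -{1}vE.
case: ifPn => [wP|wP].
  by rewrite inE => /eqP->; exists w, t.
case/flattenP => L /mapP[[c t'] + ->].
rewrite (kidsP _ _ bt) => /and3P[/eqP gc bc _] /=; apply: IH.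
- by rewrite wf_rcons vw gc eqxx.
- by rewrite last_colour_rcons.
- move=> v vP /prefixP[u]; case/lastP: u => [|u d]; first by rewrite cats0.
  rewrite -rcons_cat => /rcons_inj[wE _]; case/negP: wP.
  by rewrite -(pre _ vP) // wE prefix_prefix.
- by move=> u; rewrite cat_rcons => vu su; apply: cov; rewrite //= su.
Qed.

(** As no word of [P] is a proper prefix of another, the division does not stop
    before it reaches a given word of [P]. *)
Lemma arcs_of_complete P k t w t' u : valid (w ++ u) ->
  borders t (last_colour None w) -> first_arc t' u = t ->
  borders t' (last_colour None (w ++ u)) ->
  w ++ u \in P -> (size u <= k)%N ->
  (forall v v', v \in P -> v' \in P -> prefix v v' -> v = v') ->
  arc_interval t' (w ++ u) \in arcs_of P k t w.
Proof.
move=> + + + + + + pre; elim: k t w u => [|k IH] t w [|c u] //=.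
- by rewrite cats0 => _ _ -> _ _ _; rewrite mem_head.
- by rewrite cats0 => _ _ -> _ -> _; rewrite mem_head.
move=> vu bt tE bt' uP su; case: ifPn => [wP|wP].
  have /eqP := pre _ _ wP uP (prefix_prefix _ _).
  by rewrite -{1}[w]cats0 eqseq_cat // eqxx.
have vu' := vu; move: vu'; rewrite wf_cat /= => /and3P[_ gc cu].
rewrite last_colour_cat in bt'.
have bc := borders_first (o := Some (letter_colour c)) cu bt'.
apply/flattenP; exists (arcs_of P k (first_arc t' u) (rcons w c)).
  apply/mapP; exists (c, first_arc t' u) => //.
  by rewrite (kidsP _ _ bt) gc bc tE eqxx.
rewrite -cat_rcons; apply: IH; rewrite ?cat_rcons //.
- by rewrite last_colour_rcons.
- by rewrite last_colour_cat.
Qed.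

Lemma maps_linearly_arc (g : circle R -> circle R) t w w' :
  (forall s, 0 <= s <= 1 -> g (spot (place t w s)) = spot (place t w' s)) ->
  maps_linearly g (arc_interval t w) (arc_interval t w').
Proof.
move=> h x y /= /andP[x0 x1] yE; rewrite !circle_class_spot.
have k0 := span_gt0 t w.
pose s := (val x - place t w 0) / span t w.
have xE : val x = place t w s.
  by rewrite place_span /s mulrC divfK ?gt_eqF // addrC subrK.
have -> : val y = place t w' s.
  apply: etrans yE _; rewrite [RHS]place_span /s /span.
  by rewrite mulrAC -mulrA.
rewrite xE; apply: h; rewrite /s divr_ge0 ?subr_ge0 ?(ltW k0) //=.
  by rewrite ler_pdivrMr // mul1r lerD2r.
by rewrite -subr_ge0 ltW.
Qed.

Lemma circle_action_thompson (f : homeo airplane) :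
  T_A f -> thompson_T R (circle_action f).
Proof.
move=> Tf; have [n fn] := rearrangement_canonical_at Tf.
have [F [m [FP Fm Fc]]] := canonical_image fn.
pose P := level_words n; pose P' := map F P.
have preP v v' : v \in P -> v' \in P -> prefix v v' -> v = v'.
  rewrite !mem_level_words => /andP[_ /eqP sv] /andP[_ /eqP sv'].
  move=> /prefixP[u v'E]; move: sv'; rewrite v'E size_cat sv.
  by case: u {v'E} => [|d u]; rewrite ?cats0 //= => /eqP; lia.
have preP' v v' : v \in P' -> v' \in P' -> prefix v v' -> v = v'.
  move=> /mapP[w wP ->] /mapP[w' w'P ->] /prefixP[u uE].
  have iw := canonical_inv (homeoK f) (FP _ wP).
  have iw' := canonical_inv (homeoK f) (FP _ w'P); rewrite uE in iw'.
  have w'E := canonical_unique_cat iw iw'.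
  by rewrite (preP w w') // w'E prefix_prefix.
have neP' v : v \in P' -> v != [::].
  by case/mapP => w wP ->; have [[_ _ _ n' _] _] := FP _ wP.
have okP w : w \in P -> valid w by rewrite mem_level_words => /andP[].
have root Q k v t : v \in Q -> valid v -> borders t (last_colour None v) ->
    (size v <= k)%N -> (forall v v', v \in Q -> v' \in Q -> prefix v v' -> v = v') ->
    arc_interval t v \in arcs_of Q k Whole [::].
  move=> vQ vv bt sv pre; apply: (@arcs_of_complete Q k Whole [::] t v) => //.
  exact: borders_whole (borders_first vv bt).
have mapsP w t : w \in P -> borders t (last_colour None w) ->
    maps_linearly (circle_action f) (arc_interval t w) (arc_interval t (F w)).
  move=> wP bt; apply: maps_linearly_arc => s s01.
  exact: circle_action_place (FP _ wP) bt s01.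
exists (arcs_of P n.+1 Whole [::]), (arcs_of P' m.+1 Whole [::]).
split; [exact: dyadic_arcs_of|exact: dyadic_arcs_of|..].
- move=> I /arcs_of_sound[||||w [t [wP bt ->]]] //.
  + by move=> v _; rewrite prefixs0 => /eqP.
  + move=> u /= vu su; exists u; last exact: prefix_refl.
    by rewrite mem_level_words vu su eqxx.
  exists (arc_interval t (F w)); last exact: mapsP.
  have [tw _] := FP _ wP; have [_ _ vF _ _] := tw.
  apply: root => //; first exact: map_f.
    by rewrite -(twin_last_colour tw).
  exact/leqW/Fm.
- move=> I /arcs_of_sound[||||w' [t [/mapP[w wP ->] bt ->]]] //.
  + by move=> v _; rewrite prefixs0 => /eqP.
  + move=> u /= vu su; have [|w [x [wP ->]]] := Fc _ vu; first by rewrite su.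
    by exists (F w); [exact: map_f|exact: prefix_prefix].
  have [tw _] := FP _ wP.
  have bw : borders t (last_colour None w) by rewrite (twin_last_colour tw).
  exists (arc_interval t w); last exact: mapsP.
  apply: root => //; first exact: okP.
  by move: wP; rewrite mem_level_words => /andP[_ /eqP->].
Qed.

End Circle.

(** * The embedding *)

Lemma image_subgroup (G G' : groupType) (H : set G) (phi : G -> G') :
  is_subgroup H ->
  (forall x y, H x -> H y -> phi (x * y)%g = (phi x * phi y)%g) ->
  is_subgroup (phi @` H).
Proof.
move=> [/set_mem H1 HD] phiM.
have phi1 : phi 1%g = 1%g.
  by apply: (mulgI (phi 1%g)); rewrite -phiM // !mulg1.
split; first by apply/mem_set; exists 1%g.
move=> _ _ /set_mem[x Hx <-] /set_mem[y Hy <-].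
have Hxy : H (x / y)%g by apply/set_mem/HD; apply/mem_set.
apply/mem_set; exists (x / y)%g => //.
by apply: (mulIg (phi y)); rewrite -phiM // !divgK.
Qed.

Theorem theorem7p1 (R : realType) :
  exists H : set (homeo (circle R)),
    H `<=` thompson_T R /\ subgroup_isomorphic T_A H.
Proof.
exists (@circle_action R @` T_A); split.
  by move=> _ [f Tf <-]; exact: circle_action_thompson.
split; [exact: T_A_subgroup| |].
  by apply: image_subgroup T_A_subgroup _ => f g; exact: circle_actionM.
exists (@circle_action R); split; last by move=> f g; exact: circle_actionM.
split=> [f Tf|f g|_ [f Tf <-]].
- by exists f.
- exact: circle_action_inj.
- by exists f.
Qed.
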